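(* Let $\mathcal{O}_{ad}$ be an admissible family of open subsets of $\mathbb{R}^d$, let $\mathcal{J}\colon \mathcal{O}_{ad}\to\mathbb{R}$ be a functional, and let $\mu\in\mathcal{P}_{ad}(\mathbb{R}^d)$. Assume that $\mathcal{J}$ is shape-differentiable at $\Omega_\mu$, with shape derivative $d_S\mathcal{J}(\Omega_\mu)$. Let $\phi\in C_0^\infty(\mathbb{R}^d)$ and let $\{\mu_t\}_{t\in[0,T]}$, $T>0$, be a narrowly continuous curve in $\mathcal{P}_2(\mathbb{R}^d)$ with $\mu_0=\mu$ which satisfies the continuity equation with respect to the vector field $\nabla\phi$. Then $\mu_t\in\mathcal{P}_{ad}(\mathbb{R}^d)$ for all small $t>0$, the map $t\mapsto\widetilde{\mathcal{J}}(\mu_t)$ is differentiable at $t=0$, and its derivative at $t=0$ equals $\langle d_S\mathcal{J}(\Omega_\mu),\nabla\phi\rangle$.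
   Context: $\mathcal{P}_2(\mathbb{R}^d)$ is the set of Borel probability measures on $\mathbb{R}^d$ with finite second moment. $C_0^\infty$ denotes smooth compactly supported functions, and $\mathrm{Id}$ is the identity map of $\mathbb{R}^d$. Elements of $W^{1,\infty}(\mathbb{R}^d;\mathbb{R}^d)$ are identified with their bounded Lipschitz representatives. A curve $\{\mu_t\}_{t\in[0,T]}$ in $\mathcal{P}_2(\mathbb{R}^d)$ is narrowly continuous if $\mu_s\to\mu_t$ weakly as measures as $s\to t$, for each $t\in[0,T]$. It satisfies the continuity equation with respect to a (possibly time-dependent) Borel vector field $\theta_t$ if for all $\psi\in C_0^\infty((0,T)\times\mathbb{R}^d)$, $$\int_0^T\int_{\mathbb{R}^d}\big(\partial_t\psi(t,x)+\nabla_x\psi(t,x)\cdot\theta_t(x)\big)\,d\mu_t(x)\,dt=0 .$$ Since the curve is defined on $[0,T]$, differentiability at $t=0$ is one-sided. Let $\mathcal{O}$ be the set of all open subsets of $\mathbb{R}^d$ and $\mathcal{O}_{ad}\subset\mathcal{O}$ a subfamily. $\mathcal{O}_{ad}$ is admissible if it is stable under small perturbations: for every $\Omega\in\mathcal{O}_{ad}$ there is $r>0$ such that $(\mathrm{Id}+\theta)(\Omega)\in\mathcal{O}_{ad}$ for all $\theta\in W^{1,\infty}(\mathbb{R}^d;\mathbb{R}^d)$ with $\|\theta\|_{W^{1,\infty}}<r$. $\mathcal{J}\colon\mathcal{O}_{ad}\to\mathbb{R}$ is shape-differentiable at $\Omega\in\mathcal{O}_{ad}$ if there is a bounded linear functional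 $d_S\mathcal{J}(\Omega)$ on $W^{1,\infty}(\mathbb{R}^d;\mathbb{R}^d)$ (the shape derivative) such that $$\mathcal{J}((\mathrm{Id}+\theta)(\Omega))=\mathcal{J}(\Omega)+\langle d_S\mathcal{J}(\Omega),\theta\rangle+o(\theta),\qquad \frac{o(\theta)}{\|\theta\|_{W^{1,\infty}}}\to 0\ \text{ as } \|\theta\|_{W^{1,\infty}}\to 0 .$$ For $\mu\in\mathcal{P}_2(\mathbb{R}^d)$ put $\Omega_\mu:=\mathrm{Int}(\mathrm{supp}[\mu])$ (interior of the support) and $\pi(\mu):=\Omega_\mu$. Put $\mathcal{P}_{ad}(\mathbb{R}^d):=\{\mu\in\mathcal{P}_2(\mathbb{R}^d)\mid \Omega_\mu\in\mathcal{O}_{ad}\}$ and $\widetilde{\mathcal{J}}:=\mathcal{J}\circ\pi\colon\mathcal{P}_{ad}(\mathbb{R}^d)\to\mathbb{R}$, i.e. $\widetilde{\mathcal{J}}(\mu)=\mathcal{J}(\Omega_\mu)$. *)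

(* Defs.v *)
From HB Require Import structures.
From mathcomp Require Import all_boot all_order all_algebra.
From mathcomp Require Import all_classical all_reals all_analysis.

Set Implicit Arguments.
Unset Strict Implicit.
Unset Printing Implicit Defensive.

Import Order.TTheory GRing.Theory Num.Theory.
Import numFieldNormedType.Exports.

Local Open Scope classical_set_scope.
Local Open Scope ring_scope.

Section Euclidean.
Context {R : realType} {d : nat}.
Implicit Types u v x : 'rV[R]_d.

Definition dot u v : R := \sum_(i < d) u 0 i * v 0 i.

(* The norm [`|x|] that the library puts on ['rV_d] is the maximum norm. *)
Definition enorm x : R := Num.sqrt (dot x x).

Definition grad (f : 'rV[R]_d -> R) x : 'rV[R]_d :=
  \row_(i < d) 'D_(delta_mx 0 i) f x.

End Euclidean.

Section Smooth.
Context {R : realType} {V : normedModType R}.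
Implicit Types (f : V -> R) (U : set V).

(* For finite-dimensional [V], which is the only case used, continuity of every
   ['D_v f] is the same as continuity of the differential, so this is C^k. *)
Fixpoint Ck (k : nat) f : Prop :=
  if k is k'.+1
  then (forall x, differentiable f x) /\ (forall v, Ck k' ('D_v f))
  else continuous f.

Definition smooth f : Prop := forall k, Ck k f.

Definition fsupp f : set V := closure [set x | f x != 0].

(* A test function on the open set [U] is represented by its extension by zero
   to the whole space. *)
Definition test_function U f : Prop :=
  [/\ smooth f, compact (fsupp f) & fsupp f `<=` U].

End Smooth.

(* R^d with its Borel sigma-algebra; as a type this is ['rV[R]_d]. *)
Definition borelRV (R : realType) (d : nat) :=
  g_sigma_algebraType (@open 'rV[R]_d).

Section Measures.
Context {R : realType} {d : nat}.
Local Notation E := 'rV[R]_d.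
Local Notation prob := (probability (borelRV R d) R).

Definition P2 (mu : prob) : Prop :=
  (\int[mu]_x ((enorm (x : E) ^+ 2)%:E) < +oo)%E.

Definition msupp (mu : prob) : set E :=
  [set x | forall U : set E, open U -> U x -> (0 < mu U)%E].

Definition Omega (mu : prob) : set E := interior (msupp mu).

Definition weak_cvg (F : set_system R) (mu : R -> prob) (nu : prob) : Prop :=
  forall f : E -> R, continuous f -> (exists M : R, forall x, `|f x| <= M) ->
    (\int[mu s]_x f x) @[s --> F] --> (\int[nu]_x f x).

(* Curves on [0, T] are represented by functions on the whole line, the values
   of which outside [0, T] are never used. *)
Definition narrowly_continuous (T : R) (mu : R -> prob) : Prop :=
  forall t : R, t \in `[0, T] -> weak_cvg (within `[0, T] (nbhs t)) mu (mu t).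

(* The integrals are extended-real-valued, so that the equation cannot hold
   through the default value that [fine] gives to an infinite integral. *)
Definition continuity_equation (T : R) (mu : R -> prob)
    (theta : R -> E -> E) : Prop :=
  measurable_fun (`]0, T[ `*` setT)
    (fun p : measurableTypeR R * borelRV R d => theta p.1 p.2 : borelRV R d) /\
  forall psi : R * E -> R, test_function (`]0, T[ `*` setT) psi ->
    (\int[lebesgue_measure]_(t in `]0%R, T[)
       \int[mu t]_x ((derive1 (fun s : R => psi (s, x : E)) t
         + dot (grad (fun y => psi (t, y)) x) (theta t x))%:E))%E = 0%E.

End Measures.

Section Shape.
Context {R : realType} {d : nat}.
Local Notation E := 'rV[R]_d.
Implicit Types (theta : E -> E) (Oad : set (set E)) (J : set E -> R).

Definition W1inf theta : Prop :=
  (exists M : R, forall x, enorm (theta x) <= M) /\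
  (exists K : R, forall x y, enorm (theta x - theta y) <= K * enorm (x - y)).

(* The least Lipschitz constant is the essential supremum of the operator norm
   of the weak differential of [theta], [theta] being Lipschitz on all of R^d. *)
Definition W1inf_norm theta : R :=
  sup [set enorm (theta x) | x in [set: E]] +
  sup [set enorm (theta p.1 - theta p.2) / enorm (p.1 - p.2)
      | p in [set p : E * E | p.1 <> p.2]].

Definition deform theta (Om : set E) : set E :=
  [set x + theta x | x in Om].

Definition admissible Oad : Prop :=
  (forall Om, Oad Om -> open Om) /\
  (forall Om, Oad Om -> exists2 r : R, 0 < r &
     forall theta, W1inf theta -> W1inf_norm theta < r ->
       Oad (deform theta Om)).

(* A functional on W^{1,oo} is represented by a functional on all vector fields,
   of which only the values on W^{1,oo} matter. *)
Definition bounded_linear_functional (L : (E -> E) -> R) : Prop :=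
  (forall (a : R) theta1 theta2, W1inf theta1 -> W1inf theta2 ->
     L (fun x => a *: theta1 x + theta2 x) = a * L theta1 + L theta2) /\
  (exists C : R, forall theta, W1inf theta ->
     `|L theta| <= C * W1inf_norm theta).

(* A shape functional J : Oad -> R is represented by a function on all sets; here
   it is evaluated on members of [Oad] only. When [Oad] is admissible,
   [deform theta Om] belongs to [Oad] for every small enough [theta]. *)
Definition is_shape_derivative Oad J (Om : set E) (L : (E -> E) -> R) : Prop :=
  [/\ Oad Om, bounded_linear_functional L &
   forall e : R, 0 < e -> exists2 r : R, 0 < r &
     forall theta, W1inf theta -> W1inf_norm theta < r ->
       Oad (deform theta Om) ->
       `|J (deform theta Om) - J Om - L theta| <= e * W1inf_norm theta].

Definition Pad Oad (mu : probability (borelRV R d) R) : Prop :=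
  P2 mu /\ Oad (Omega mu).

Definition Jtilde J (mu : probability (borelRV R d) R) : R := J (Omega mu).

End Shape.

(* Main.v *)
(* Along a test field v = grad phi the curve mu_t is the push-forward of mu by the flow X_t of v,
   but only the supports matter here, and these are found by a comparison argument that needs
   neither the regularity of X_t in x nor a uniqueness theorem for the continuity equation.
   If p is an integral curve of v and K bounds |<x - y, v x - v y>| / |x - y|^2, then
   q (t, x) = lam e^(-2Kt) |x - p t|^2 is nonincreasing along the trajectories of v, and with
   e^(2Kt) it is nondecreasing. Testing the continuity equation with chi t * eta (q (t, x)), eta a
   nonincreasing bump function, shows that t |-> \int eta (q (t, x)) d mu_t is monotone. Letting lam
   vary, p 0 is in supp mu_0 if and only if p t is in supp mu_t. As X_t is a homeomorphism,
   Omega (mu_t) = X_t (Omega mu) = (Id + theta_t)(Omega mu) with theta_t = X_t - Id, and a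
   second-order Taylor expansion of X_t x and of X_t x - X_t y gives
   theta_t = t grad phi + O(t^2) in W^{1,oo}. *)

Require Import Defs.
From HB Require Import structures.
From mathcomp Require Import all_boot all_order all_algebra.
From mathcomp Require Import all_classical all_reals all_analysis.
From mathcomp Require Import measurable_realfun.
From mathcomp Require Import ring lra.

Set Implicit Arguments.
Unset Strict Implicit.
Unset Printing Implicit Defensive.

Import Order.TTheory GRing.Theory Num.Theory.
Import numFieldNormedType.Exports.

Local Open Scope classical_set_scope.
Local Open Scope ring_scope.

(** * Row vectors and differential calculus *)

(** The direct dual argument would test the equation with [f (X_{-t} x)], and so needs the flow to
    be smooth in the initial point. A barrier sees the flow only through one curve [p], which is
    smooth in time. The price is that it obeys a differential inequality instead of the transport
    equation, and each of the two weights yields only one inclusion between supports. Their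
    exponential distortion of radii is harmless: the balls around [p t] form a neighbourhood basis
    at every time, and the only question asked of them is whether their mass is positive. The
    equation is tested on the open interval []0, T[], so the monotonicity is at first distributional
    and away from 0; narrow continuity makes it pointwise and carries it to time 0. Compact support
    of [phi] makes [v] and its derivatives bounded, which gives a flow for all times and constants
    uniform in space. This uniformity is what the norm of [W^{1,oo}] requires. *)

Section RowNorm.
Context {R : realType} {n : nat}.

Lemma coord_le_norm (x : 'rV[R]_n) i : `|x 0 i| <= `|x|.
Proof. by rewrite [leRHS]/Num.Def.normr/= mx_normrE; exact: (le_bigmax _ _ (0, i)). Qed.

Lemma row_norm_le (x : 'rV[R]_n) (e : R) :
  0 <= e -> (forall i, `|x 0 i| <= e) -> `|x| <= e.
Proof.
move=> e0 xe; rewrite [leLHS]/Num.Def.normr/= mx_normrE bigmax_le// => -[i j] _.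
by rewrite ord1.
Qed.

Lemma continuous_row {T : topologicalType} (g : T -> 'rV[R]_n) x :
  (forall i, {for x, continuous (fun y => g y 0 i)}) -> {for x, continuous g}.
Proof.
move=> cg; apply/cvgrPdist_le => e e0; near=> y.
apply: row_norm_le; first exact: ltW.
rewrite -[forall i, _]/(forall i, (fun i => `|(g x - g y) 0 i| <= e) i).
near: y; apply: filter_forall => i; have /cvgrPdist_le/(_ _ e0) := cg i.
by apply: filterS => y; rewrite !mxE.
Unshelve. all: by end_near. Qed.

End RowNorm.

Section D1.
Context {R : realType} {V : normedModType R}.
Implicit Types (f g : V -> R) (x v : V).

Lemma is_deriveD_fun f g x v a b : is_derive x v f a -> is_derive x v g b ->
  is_derive x v (fun y => f y + g y) (a + b).
Proof. exact: is_deriveD. Qed.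

Lemma is_deriveN_fun f x v a : is_derive x v f a -> is_derive x v (fun y => - f y) (- a).
Proof. exact: is_deriveN. Qed.

Lemma is_deriveB_fun f g x v a b : is_derive x v f a -> is_derive x v g b ->
  is_derive x v (fun y => f y - g y) (a - b).
Proof. exact: is_deriveB. Qed.

Lemma is_deriveM_fun f g x v a b : is_derive x v f a -> is_derive x v g b ->
  is_derive x v (fun y => f y * g y) (f x * b + g x * a).
Proof. exact: is_deriveM. Qed.

Lemma is_deriveX_fun f n x v a : is_derive x v f a ->
  is_derive x v (fun y => f y ^+ n.+1) ((n.+1%:R * f x ^+ n) * a).
Proof.
by move=> df; have := is_deriveX n.+1 df; rewrite exprfctE.
Qed.

Lemma is_derive_sum_fun n (F : 'I_n -> V -> R) (dF : 'I_n -> R) x v :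
  (forall i, is_derive x v (F i) (dF i)) ->
  is_derive x v (fun y => \sum_i F i y) (\sum_i dF i).
Proof.
move=> h; have := is_derive_sum h.
by rewrite (_ : \sum_i F i = fun y => \sum_i F i y)//; apply/funext => y; rewrite fct_sumE.
Qed.

Lemma is_derive_line f x v a :
  is_derive x v f a <-> is_derive (0 : R) 1 (fun h : R => f (h *: v + x)) a.
Proof.
have E : 'D_v f x = 'D_1 (fun h : R => f (h *: v + x)) (0 : R).
  rewrite /derive (_ : (fun h : R => h^-1 *: ((f \o shift x) (h *: v) - f x)) =
    (fun h : R => h^-1 *: (((fun h : R => f (h *: v + x)) \o shift (0 : R)) (h *: (1 : R)) -
      f ((0 : R) *: v + x))))//.
  by apply/funext => h /=; rewrite addr0 scale0r add0r [h%:A]mulr1.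
split=> -[df <-]; apply: DeriveDef; rewrite ?E//.
- exact: (derivable1P f x v).1.
- exact: (derivable1P f x v).2.
Qed.

(** Restriction to the line through [x] in the direction [v] reduces this to one variable, so that
    [f] need only be derivable in that direction. *)
Lemma is_derive_comp1 (h : R -> R) f x v a b : is_derive (f x) 1 h a ->
  is_derive x v f b -> is_derive x v (fun y => h (f y)) (a * b).
Proof.
move=> dh /is_derive_line df; apply/is_derive_line.
apply: (@is_derive1_comp _ h (fun k : R => f (k *: v + x))) => //.
by rewrite scale0r add0r.
Qed.
End D1.

Section CkCalculus.
Context {R : realType}.

Section Domain.
Context {V : normedModType R}.
Implicit Types f g : V -> R.

Lemma CkS k f : Ck k.+1 f -> Ck k f.
Proof.
elim: k f => [|k IH] f [df Df]; first by move=> x; exact: differentiable_continuous.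
by split=> // v; apply: IH; exact: Df.
Qed.

Lemma Ck_continuous k f : Ck k f -> continuous f.
Proof. by elim: k f => // k IH f /CkS/IH. Qed.

Lemma Ck_cst k (a : R) : Ck k (fun _ : V => a).
Proof.
elim: k a => [|k IH] a; first by move=> x; exact: cvg_cst.
split=> [x|v]; first exact: differentiable_cst.
rewrite (_ : 'D_v _ = fun=> 0) //; apply/funext => x; exact: derive_cst.
Qed.

Lemma CkD k f g : Ck k f -> Ck k g -> Ck k (fun x => f x + g x).
Proof.
elim: k f g => [|k IH] f g; first by move=> cf cg x; exact: (cvgD (cf x) (cg x)).
move=> [df Df] [dg Dg]; split=> [x|v]; first exact: differentiableD.
rewrite (_ : 'D_v _ = fun x => 'D_v f x + 'D_v g x).
  by apply: IH; [exact: Df|exact: Dg].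
by apply/funext => x; rewrite [LHS]deriveD//; exact: diff_derivable.
Qed.

Lemma CkM k f g : Ck k f -> Ck k g -> Ck k (fun x => f x * g x).
Proof.
elim: k f g => [|k IH] f g; first by move=> cf cg x; exact: (cvgM (cf x) (cg x)).
move=> Cf Cg; case: (Cf) (Cg) => [df Df] [dg Dg]; split=> [x|v]; first exact: differentiableM.
rewrite (_ : 'D_v _ = fun x => f x * 'D_v g x + g x * 'D_v f x).
  by apply: CkD; apply: IH; by [exact: Dg|exact: Df|exact: CkS].
by apply/funext => x; rewrite [LHS]deriveM//; exact: diff_derivable.
Qed.

Lemma Ck_sum k n (F : 'I_n -> V -> R) : (forall i, Ck k (F i)) ->
  Ck k (fun x => \sum_(i < n) F i x).
Proof.
elim: n F => [|n IH] F CF.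
  rewrite (_ : (fun _ => _) = fun=> 0); first exact: Ck_cst.
  by apply/funext => x; rewrite big_ord0.
rewrite (_ : (fun _ => _) = fun x => \sum_(i < n) F (widen_ord (leqnSn n) i) x + F ord_max x).
  by apply: CkD => //; apply: IH.
by apply/funext => x; rewrite big_ord_recr.
Qed.

Lemma Ck_comp1 k (h : R -> R) f : Ck k h -> Ck k f -> Ck k (fun x => h (f x)).
Proof.
elim: k h f => [|k IH] h f; first by move=> ch cf x; apply: continuous_comp; [exact: cf|exact: ch].
move=> [dh Dh] Cf; case: (Cf) => df Df; split=> [x|v]; first exact: differentiable_comp.
rewrite (_ : 'D_v _ = fun x => 'D_1 h (f x) * 'D_v f x).
  by apply: CkM; [apply: (IH ('D_1 h)); [exact: Dh|exact: CkS]|exact: Df].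
apply/funext => x; rewrite deriveE; last exact: differentiable_comp.
by rewrite diff_comp //= [X in _ = _ * X]deriveE// diff1E// derive1E; exact: mulrC.
Qed.

End Domain.

(* The two hypotheses on [g] say that it is linear and continuous. *)
Lemma Ck_comp_lin {V W : normedModType R} k (f : W -> R) (g : V -> W) :
  (forall x, differentiable g x) -> (forall v x, 'D_v g x = g v) ->
  Ck k f -> Ck k (fun x => f (g x)).
Proof.
move=> dg Dg; elim: k f => [|k IH] f.
  by move=> cf x; apply: continuous_comp; [exact: differentiable_continuous|exact: cf].
move=> [df Df]; split=> [x|v]; first exact: differentiable_comp.
rewrite (_ : 'D_v _ = fun x => 'D_(g v) f (g x)); first by apply: (IH ('D_(g v) f)); exact: Df.
apply/funext => x; rewrite deriveE; last exact: differentiable_comp.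
by rewrite diff_comp//= [RHS]deriveE// -(Dg v x) deriveE.
Qed.

Lemma derive_row n (f : 'rV[R]_n -> R) x v : differentiable f x ->
  'D_v f x = \sum_(i < n) v 0 i * 'D_(delta_mx 0 i) f x.
Proof.
move=> df; rewrite deriveE// {1}[v]row_sum_delta linear_sum/=.
by apply: eq_bigr => i _; rewrite linearZ/= -deriveE.
Qed.

Lemma row_as_sum {V : normedModType R} n (g : V -> 'rV[R]_n) :
  g = \sum_(i < n) (fun x => g x 0 i *: (delta_mx 0 i : 'rV[R]_n)).
Proof. by apply/funext => x; rewrite fct_sumE -row_sum_delta. Qed.

Lemma differentiable_row {V : normedModType R} n (g : V -> 'rV[R]_n) x :
  (forall i, differentiable (fun y => g y 0 i) x) -> differentiable g x.
Proof.
move=> dg; rewrite [g]row_as_sum; apply: differentiable_sum => i.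
exact: differentiableZl.
Qed.

(** [Ck] concerns scalar functions, so the regularity of the inner map is asked of its coordinates.
    The induction is over all [f], as the chain rule replaces [f] by its partial derivatives. *)
Lemma Ck_comp_row {V : normedModType R} n k (f : 'rV[R]_n -> R) (g : V -> 'rV[R]_n) :
  Ck k f -> (forall i, Ck k (fun x => g x 0 i)) -> Ck k (fun x => f (g x)).
Proof.
elim: k f g => [|k IH] f g.
  move=> cf cg x; apply: continuous_comp; [|exact: cf].
  by apply: continuous_row => i; exact: cg.
move=> [df Df] Cg; have dg x : differentiable g x.
  by apply: differentiable_row => i; exact: (Cg i).1.
split=> [x|v]; first exact: differentiable_comp.
rewrite (_ : 'D_v _ = fun x =>
  \sum_(i < n) 'D_v (fun y => g y 0 i) x * 'D_(delta_mx 0 i) f (g x)).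
  apply: Ck_sum => i; apply: CkM; first exact: (Cg i).2.
  by apply: (IH ('D_(delta_mx 0 i) f)) => [|j]; [exact: Df|exact: CkS].
apply/funext => x; rewrite deriveE; last exact: differentiable_comp.
rewrite diff_comp//= -(deriveE v (dg x)) -deriveE// derive_row//; apply: eq_bigr => i _.
by rewrite derive_mx ?mxE//; exact: diff_derivable.
Qed.

Lemma derive_coord n (v x : 'rV[R]_n) i : 'D_v (fun x : 'rV[R]_n => x 0 i : R) x = v 0 i.
Proof.
have := @derive_mx _ _ 1 n id x v (@derivable_id _ _ x v).
by rewrite derive_id => /matrixP/(_ 0 i); rewrite mxE.
Qed.

Lemma Ck_coord n k i : Ck k (fun x : 'rV[R]_n => x 0 i).
Proof.
case: k => [x|k]; first exact: coord_continuous.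
split=> [x|v]; first exact: differentiable_coord.
by rewrite (_ : 'D_v _ = fun=> v 0 i); [exact: Ck_cst|apply/funext => x; exact: derive_coord].
Qed.

End CkCalculus.

(** * Smooth bump functions *)

Section Bump.
Context {R : realType}.

(* [flat n r = r^-n e^(-1/r)] for [r > 0]. The family is stable under differentiation, hence
   consists of smooth functions; [flat 0] is the usual building block of bump functions. *)
Definition flat (n : nat) (r : R) : R :=
  if 0 < r then r^-1 ^+ n * expR (- r^-1) else 0.

Lemma flat_pos n r : 0 < r -> flat n r = r^-1 ^+ n * expR (- r^-1).
Proof. by rewrite /flat => ->. Qed.

Lemma flat_neg n r : r <= 0 -> flat n r = 0.
Proof. by rewrite /flat leNgt => /negbTE ->. Qed.

Lemma flat_gt0 n r : 0 < r -> 0 < flat n r.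
Proof. by move=> r0; rewrite flat_pos// mulr_gt0 ?expR_gt0// exprn_gt0 ?invr_gt0. Qed.

Lemma flat_ge0 n r : 0 <= flat n r.
Proof. by have [/(flat_neg n)->|/(flat_gt0 n)/ltW] := leP r 0. Qed.

(** With [y = 1/r], one term of the exponential series gives [y^(n+2) / (n+2)! <= e^y], that is
    [y^n e^(-y) <= (n+2)! r^2]. A quadratic bound makes the derivative at 0 exist and vanish. *)
Lemma flat_quadratic n : exists2 C, 0 <= C & forall r, `|flat n r| <= C * `|r| ^+ 2.
Proof.
exists ((n.+2)`!%:R) => // r; have [r0|r0] := leP r 0.
  by rewrite flat_neg// normr0 mulr_ge0// exprn_ge0.
rewrite flat_pos// ger0_norm; last by rewrite mulr_ge0 ?expR_ge0// exprn_ge0// invr_ge0 ltW.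
have y0 : 0 < r^-1 by rewrite invr_gt0.
have := expR_ge1Dxn n.+1 (ltW y0).
rewrite (gtr0_norm r0) expRN => h.
have F0 : 0 < n.+2`!%:R :> R by rewrite ltr0n fact_gt0.
have e1 : r^-1 ^+ n.+2 / n.+2`!%:R <= expR r^-1.
  by apply: le_trans h; rewrite lerDr.
rewrite ler_pdivrMr ?expR_gt0//.
apply: le_trans (_ : n.+2`!%:R * r ^+ 2 * (r^-1 ^+ n.+2 / n.+2`!%:R) <= _); last first.
  by rewrite ler_wpM2l// mulr_ge0// exprn_ge0// ltW.
rewrite le_eqVlt; apply/orP; left; apply/eqP.
rewrite !exprS expr0; field.
by rewrite !gt_eqF.
Qed.

Lemma flat_is_derive n (r : R) :
  is_derive r 1 (flat n) (- n%:R * flat n.+1 r + flat n.+2 r).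
Proof.
have [r0|r0|->] := ltgtP r 0.
- have nearE : \near r, cst 0 r = flat n r.
    near=> s; rewrite flat_neg// ltW//; near: s.
    by apply: lt_nbhsl.
  apply: near_eq_is_derive nearE _.
  by rewrite !flat_neg ?ltW// mulr0 addr0; exact: is_derive_cst.
- have nearE : \near r, (fun s => s^-1 ^+ n * expR (- s^-1)) r = flat n r.
    near=> s; rewrite flat_pos//; near: s.
    by apply: lt_nbhsr.
  apply: near_eq_is_derive nearE _.
  have dV : is_derive r 1 (fun s : R => s^-1) (- r ^- 2).
    by have := is_deriveV (lt0r_neq0 r0) (@is_derive_id _ _ r (1 : R)); rewrite [_ *: 1]mulr1.
  have dE : is_derive r 1 (fun s : R => expR (- s^-1)) (expR (- r^-1) * - - r ^- 2).
    exact: is_derive_comp1.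
  have dX : is_derive r 1 (fun s : R => s^-1 ^+ n) (n%:R * r^-1 ^+ n.-1 * - r ^- 2).
    case: n => [|n]; first by rewrite !mul0r; exact: is_derive_cst.
    exact: is_deriveX_fun.
  have -> : - n%:R * flat n.+1 r + flat n.+2 r =
      r^-1 ^+ n * (expR (- r^-1) * - - r ^- 2) +
      expR (- r^-1) * (n%:R * r^-1 ^+ n.-1 * - r ^- 2).
    rewrite !flat_pos// -!exprVn opprK; set y := r^-1.
    case: n {dX} => [|n]; rewrite !exprS expr0 //= ?exprS; ring.
  exact: is_deriveM_fun.
- rewrite !flat_neg// mulr0 addr0.
  have [C C0 hC] := flat_quadratic n.
  have : h^-1 *: (flat n (h *: (1:R) + 0) - flat n 0) @[h --> 0^'] --> (0 : R).
    apply/cvgrPdist_le => e e0; near=> h.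
    have hn0 : h != 0 by near: h; exact: nbhs_dnbhs_neq.
    rewrite sub0r normrN addr0 [h *: 1]mulr1 [flat n 0]flat_neg// subr0 [_ *: _]/(_ * _).
    rewrite normrM normfV mulrC ler_pdivrMr ?normr_gt0//.
    apply: le_trans (hC h) _; rewrite exprS expr1 mulrA ler_wpM2r//.
    apply: le_trans (_ : (C + 1) * `|h| <= _); first by rewrite ler_wpM2r// lerDl.
    rewrite mulrC -ler_pdivlMr ?ltr_wpDl//.
    by near: h; apply: dnbhs0_le; rewrite divr_gt0// ltr_wpDl.
  move=> h; apply: DeriveDef; last by apply: cvg_lim.
  by apply/cvg_ex; exists 0.
Unshelve. all: by end_near. Qed.

Lemma Ck_derive1 k (f g : R -> R) :
  (forall x : R, is_derive x (1 : R) f (g x)) -> Ck k g -> Ck k.+1 f.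
Proof.
move=> Df Cg; split=> [x|v]; first by apply/derivable1_diffP; have [] := Df x.
rewrite (_ : 'D_v _ = fun x => v * g x); first by apply: CkM => //; exact: Ck_cst.
apply/funext => x; have dx : differentiable f x by apply/derivable1_diffP; have [] := Df x.
by rewrite deriveE// diff1E// derive1E derive_val.
Qed.

Lemma flat_smooth n k : Ck k (flat n).
Proof.
elim: k n => [|k IH] n.
  move=> x; apply/differentiable_continuous/derivable1_diffP.
  by have [] := flat_is_derive n x.
apply: (@Ck_derive1 _ _ (fun r => - n%:R * flat n.+1 r + flat n.+2 r)).
  exact: flat_is_derive.
by apply: CkD => //; apply: CkM => //; exact: Ck_cst.
Qed.

End Bump.

(** * Primitives and the flow of a bounded Lipschitz vector field *)

Section Primitive.
Context {R : realType}.
Implicit Types f g : R -> R.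

Lemma is_derive_continuous f (t a : R) : is_derive t (1 : R) f a -> {for t, continuous f}.
Proof. by case=> /derivable1_diffP/differentiable_continuous. Qed.

Lemma within_continuous_is_derive f (g : R -> R) (a b : R) :
  (forall t, a <= t <= b -> is_derive t (1 : R) f (g t)) -> {within `[a, b], continuous f}.
Proof.
move=> Df; apply: derivable_within_continuous => t; rewrite in_itv/= => tab.
by have [] := Df _ tab.
Qed.

Lemma ge0_derive_le f (g : R -> R) (a b : R) : a <= b ->
  (forall t, a <= t <= b -> is_derive t (1 : R) f (g t)) ->
  (forall t, a <= t <= b -> 0 <= g t) -> f a <= f b.
Proof.
move=> ab Df g0.
have [||c cab E] := @MVT_segment _ f g _ _ ab.
- by move=> t; rewrite in_itv/= => /andP[ta tb]; apply: Df; rewrite !ltW.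
- exact: (within_continuous_is_derive Df).
- rewrite -subr_ge0 E mulr_ge0 ?subr_ge0// g0//.
Qed.

Lemma derive_le f (g : R -> R) (M a b : R) : a <= b ->
  (forall t, a <= t <= b -> is_derive t (1 : R) f (g t)) ->
  (forall t, a <= t <= b -> `|g t| <= M) -> `|f b - f a| <= M * (b - a).
Proof.
move=> ab Df g0.
have [||c cab E] := @MVT_segment _ f g _ _ ab.
- by move=> t; rewrite in_itv/= => /andP[ta tb]; apply: Df; rewrite !ltW.
- exact: (within_continuous_is_derive Df).
- rewrite E normrM (ger0_norm (_ : 0 <= b - a)) ?subr_ge0// ler_wpM2r ?subr_ge0// g0//.
Qed.

Lemma is_derive_comp_opp f (t a : R) : is_derive (- t) (1 : R) f a ->
  is_derive t (1 : R) (fun s => f (- s)) (- a).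
Proof.
move=> df; rewrite -mulrN1; exact: is_derive_comp1.
Qed.

Let half f (t : R) := \int[lebesgue_measure]_(s in `[-1, t]) f s -
                \int[lebesgue_measure]_(s in `[-1, 0]) f s.

Let half0 f : half f 0 = 0.
Proof. by rewrite /half subrr. Qed.

Let half_derive f (t : R) : continuous f -> -1 < t -> is_derive t (1 : R) (half f) (f t).
Proof.
move=> cf t1.
have [] := @continuous_FTC1_closed R f (-1) t (t + 1) _ _ t1 (cf t).
- by rewrite ltrDl.
- apply: continuous_compact_integrable; first exact: segment_compact.
  exact: continuous_subspaceT.
move=> dF EF.
have D1 := DeriveDef dF (etrans (esym (derive1E _ _)) EF).
rewrite -[f t]subr0.
exact: (is_deriveB_fun D1 (is_derive_cst (\int[lebesgue_measure]_(s in `[-1, 0]) f s) _ _)).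
Qed.

(** An integral with base point -1 is differentiated at times larger than -1 only. The reflected
    function [neg] serves the times smaller than 1. Both vanish at 0 and have the same derivative on
    the overlap, so they glue to a primitive on the whole line. *)
Lemma primitive_ex f : continuous f ->
  {F : R -> R | F 0 = 0 & forall t, is_derive t (1 : R) F (f t)}.
Proof.
move=> cf; pose fN t := f (- t).
have cfN : continuous fN.
  by move=> t; apply: continuous_comp; [exact: oppr_continuous|exact: cf].
pose neg t := - half fN (- t).
have negD (t : R) : t < 1 -> is_derive t (1 : R) neg (f t).
  move=> t1; rewrite -[f t]opprK; apply: is_deriveN_fun; apply: is_derive_comp_opp.
  by rewrite -[t in f t]opprK; apply: half_derive => //; rewrite ltrN2.
have agree (t : R) : -1 < t < 1 -> half f t = neg t.
  move=> /andP[ta tb].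
  have D (s : R) : -1 < s < 1 -> is_derive s (1 : R) (fun s => half f s - neg s) 0.
    move=> /andP[sa sb]; rewrite -(subrr (f s)).
    by apply: is_deriveB_fun; [exact: half_derive|exact: negD].
  have n0 : neg 0 = 0 by rewrite /neg oppr0 half0 oppr0.
  apply/eqP; rewrite -subr_eq0; apply/eqP.
  have [t0|t0] := leP 0 t.
    have := @derive_le (fun s => half f s - neg s) (fun=> 0) 0 0 t t0.
    rewrite half0 n0 !subr0 mul0r => H; apply/eqP; rewrite -normr_le0; apply: H => s.
      by move=> ?; apply: D; lra.
    by rewrite normr0.
  have := @derive_le (fun s => half f s - neg s) (fun=> 0) 0 t 0 (ltW t0).
  rewrite half0 n0 subr0 sub0r normrN mul0r => H; apply/eqP; rewrite -normr_le0; apply: H => s.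
    by move=> ?; apply: D; lra.
  by rewrite normr0.
exists (fun t => if 0 <= t then half f t else neg t); first by rewrite lexx half0.
(* Splitting at 1/2 instead of the gluing point 0 leaves around every [t] a neighbourhood on which
   one of the two formulas is valid. *)
move=> t; have [t0|t0] := ltP t (1/2).
- apply: near_eq_is_derive (negD t _); last by lra.
  near=> s; have s1 : s < 1 by near: s; apply: lt_nbhsl; lra.
  case: leP => // s0; apply/esym/agree; lra.
- apply: near_eq_is_derive (half_derive _ _) => //; last by lra.
  near=> s; have s1 : 0 < s by near: s; apply: lt_nbhsr; lra.
  by rewrite ltW.
Unshelve. all: by end_near. Qed.

End Primitive.

Section Flow.
Context {R : realType} {d : nat}.
Local Notation E := 'rV[R]_d.

(** Integrating the exponential bound gains the factor [1 / a], which is the source of the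
    contraction of the Picard map. *)
Lemma derive_le_expR (F g : R -> R) (K a t : R) : 0 < a -> F 0 = 0 ->
  (forall s : R, is_derive s (1 : R) F (g s)) ->
  (forall s : R, `|g s| <= K * expR (a * `|s|)) ->
  `|F t| <= K / a * expR (a * `|t|).
Proof.
move=> a0; wlog t0 : F g t / 0 <= t.
  move=> H F0 DF gK; have [/H|t0] := leP 0 t; first exact.
  have := H (fun s => F (- s)) (fun s => - g (- s)) (- t).
  rewrite opprK normrN oppr0 oppr_ge0; apply=> //; first exact: ltW.
    by move=> s; apply: is_derive_comp_opp.
  by move=> s; rewrite normrN; have := gK (- s); rewrite normrN.
move=> F0 DF gK; have K0 : 0 <= K.
  by have := gK 0; rewrite normr0 mulr0 expR0 mulr1; apply: le_trans.
have DE (s : R) : is_derive s (1 : R) (fun s => K / a * expR (a * s)) (K * expR (a * s)).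
  have Da : is_derive s (1 : R) (fun s => a * s) a.
    by have := is_deriveM_fun (is_derive_cst a s 1) (is_derive_id s 1); rewrite mulr1 mulr0 addr0.
  have De := is_derive_comp1 (is_derive_expR _) Da.
  have := is_deriveM_fun (is_derive_cst (K / a) s 1) De.
  rewrite mulr0 addr0 => h; apply: is_derive_eq h _.
  by rewrite mulrCA mulrC; congr (_ * _); rewrite divfK ?gt_eqF.
have Ka : 0 <= K / a by rewrite divr_ge0// ltW.
rewrite (ger0_norm t0) ler_norml; apply/andP; split.
  have /= := ge0_derive_le t0 (fun s _ => is_deriveD_fun (DE s) (DF s)).
  rewrite F0 mulr0 expR0 mulr1 addr0 => H; have := H _; rewrite -lerBlDr => {}H.
  suff P s : 0 <= s <= t -> 0 <= K * expR (a * s) + g s by have := H P; lra.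
  move=> /andP[s0 _]; have := gK s; rewrite (ger0_norm s0) ler_norml => /andP[+ _].
  by lra.
have /= := ge0_derive_le t0 (fun s _ => is_deriveB_fun (DE s) (DF s)).
rewrite F0 mulr0 expR0 mulr1 subr0 => H.
suff P s : 0 <= s <= t -> 0 <= K * expR (a * s) - g s by have := H P; lra.
move=> /andP[s0 _]; have := gK s; rewrite (ger0_norm s0) ler_norml => /andP[_ +].
by lra.
Qed.

(* For [f] not continuous the value is junk. *)
Definition prim (f : R -> R) : R -> R :=
  if pselect (continuous f) is left cf then sval (primitive_ex cf) else f.

Lemma prim0 f : continuous f -> prim f 0 = 0.
Proof. by rewrite /prim; case: pselect => // cf _; case: primitive_ex. Qed.

Lemma prim_derive f t : continuous f -> is_derive t (1 : R) (prim f) (f t).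
Proof. by rewrite /prim; case: pselect => // cf _; case: primitive_ex. Qed.

Variables (v : E -> E) (L M : R).
Hypothesis L1 : 1 <= L.
Hypothesis v_lip : forall x y i, `|v x 0 i - v y 0 i| <= L * `|x - y|.
Hypothesis v_bnd : forall x i, `|v x 0 i| <= M.

Let L0 : 0 < L. Proof. exact: lt_le_trans L1. Qed.

Let v_cont (Z : R -> E) i : continuous Z -> continuous (fun s => v (Z s) 0 i).
Proof.
move=> cZ t; apply/cvgrPdist_le => e e0; near=> s.
apply: le_trans (v_lip _ _ _) _; rewrite mulrC -ler_pdivlMr//.
near: s; have /cvgrPdist_le := cZ t; apply; exact: divr_gt0.
Unshelve. all: by end_near. Qed.

Variable x : E.

Let step (Z : R -> E) (t : R) : E := \row_i (x 0 i + prim (fun s => v (Z s) 0 i) t).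

Let step_derive Z i (t : R) : continuous Z ->
  is_derive t (1 : R) (fun s => step Z s 0 i) (v (Z t) 0 i).
Proof.
move=> cZ; rewrite (_ : (fun s => step Z s 0 i) =
  (fun s => x 0 i + prim (fun s => v (Z s) 0 i) s)); last first.
  by apply/funext => s; rewrite mxE.
have := is_deriveD_fun (is_derive_cst (x 0 i) t 1) (prim_derive t (@v_cont Z i cZ)).
by rewrite add0r.
Qed.

Let step_continuous Z : continuous Z -> continuous (step Z).
Proof.
move=> cZ t; apply: continuous_row => i.
exact: is_derive_continuous (step_derive i t cZ).
Qed.

Let M0 (i : 'I_d) : 0 <= M. Proof. exact: le_trans (v_bnd x i). Qed.

Let step_lip Z i (s t : R) : continuous Z -> `|step Z s 0 i - step Z t 0 i| <= M * `|s - t|.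
Proof.
move=> cZ; wlog st : s t / t <= s.
  by move=> H; have [/H//|/ltW/H] := leP t s; rewrite distrC [in leRHS]distrC.
rewrite (ger0_norm (_ : 0 <= s - t)) ?subr_ge0//.
apply: (derive_le st (fun r _ => step_derive i r cZ)) => r _; exact: v_bnd.
Qed.

(* For the weighted sup distance with weight [e^(-2L|t|)] the Picard map [step] contracts by a
   factor 1/2 on the whole line, so that the flow is obtained at once for all times. *)
Let a := 2 * L.
Let a0 : 0 < a. Proof. by rewrite mulr_gt0. Qed.

Let step_contr Z W (K t : R) : 0 <= K -> continuous Z -> continuous W ->
  (forall s, `|Z s - W s| <= K * expR (a * `|s|)) ->
  `|step Z t - step W t| <= K / 2 * expR (a * `|t|).
Proof.
move=> K0 cZ cW H; apply: row_norm_le => [|i].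
  by rewrite mulr_ge0 ?expR_ge0// divr_ge0.
have -> : K / 2 = L * K / a by rewrite /a; field; rewrite gt_eqF.
have -> : (step Z t - step W t) 0 i =
    prim (fun s => v (Z s) 0 i) t - prim (fun s => v (W s) 0 i) t.
  by rewrite !mxE; ring.
pose F (s : R) := prim (fun s => v (Z s) 0 i) s - prim (fun s => v (W s) 0 i) s.
rewrite -[X in `|X|]/(F t).
apply: (@derive_le_expR F (fun s => v (Z s) 0 i - v (W s) 0 i) (L * K) a t a0).
- by rewrite /F !prim0 ?subrr//; exact: v_cont.
- by move=> s; apply: is_deriveB_fun; apply: prim_derive; exact: v_cont.
- by move=> s /=; apply: le_trans (v_lip _ _ _) _; rewrite -mulrA ler_wpM2l// ltW.
Qed.

Let Z n := iter n step (fun=> x).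

Let Zc n : continuous (Z n).
Proof. by elim: n => [|n IH]; [move=> t; exact: cvg_cst|exact: step_continuous]. Qed.

(** In dimension 0 the bound [v_bnd] is vacuous and [M] may be negative. *)
Let K := Num.max M 0.

Let Zstep n (t : R) : `|Z n.+1 t - Z n t| <= K * (1 / 2) ^+ n * expR (a * `|t|).
Proof.
elim: n t => [|n IH] t.
  rewrite expr0 mulr1; apply: row_norm_le => [|i].
    by rewrite mulr_ge0 ?expR_ge0// le_max lexx orbT.
  rewrite !mxE addrAC subrr add0r.
  apply: (@le_trans _ _ (M * `|t|)).
    have := step_lip i t 0 (@Zc 0); rewrite !mxE prim0; last exact: (@v_cont _ _ (@Zc 0)).
    by rewrite addr0 addrAC subrr add0r subr0.
  apply: ler_pM => //; first exact: M0; first by rewrite le_max lexx.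
  (* Linear growth in time is absorbed by the weight: [|t| <= a |t| < e^(a|t|)], where [1 <= L]
     enters. *)
  have := expR_ge1Dx (a * `|t|); have : `|t| <= a * `|t|.
    by rewrite ler_peMl// /a; have := L1; lra.
  lra.
rewrite exprSr mulrA mulrA mulr1.
apply: (@step_contr (Z n.+1) (Z n) (K * (1 / 2) ^+ n) t _ (@Zc _) (@Zc _) IH).
by rewrite mulr_ge0 ?exprn_ge0// le_max lexx orbT.
Qed.

Let Ztail n m (t : R) : `|Z (m + n)%N t - Z n t| <= 2 * K * (1 / 2) ^+ n * expR (a * `|t|).
Proof.
have K0 : 0 <= K by rewrite le_max lexx orbT.
(* The subtracted term is the remaining tail of the geometric series; it makes the induction on [m]
   close. *)
apply: (@le_trans _ _ ((2 * K * (1 / 2) ^+ n - 2 * K * (1 / 2) ^+ (m + n)) * expR (a * `|t|))).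
  elim: m => [|m IH]; first by rewrite !subrr normr0 mul0r.
  rewrite -(subrKA (Z (m + n)%N t)); apply: le_trans (ler_normD _ _) _.
  apply: le_trans (lerD (Zstep (m + n) t) IH) _.
  rewrite -mulrDl ler_wpM2r ?expR_ge0// addSn exprS; lra.
rewrite ler_wpM2r ?expR_ge0// gerBl mulr_ge0 ?exprn_ge0//; lra.
Qed.

Let geo (c : R) : (fun n : nat => c * (1 / 2) ^+ n) @ \oo --> (0 : R).
Proof. by apply: (@cvg_geometric R c (1/2)); rewrite ger0_norm; lra. Qed.

Let Zcvg (t : R) : cvg ((fun n => Z n t) @ \oo).
Proof.
apply/cauchy_cvgP/cauchy_exP => e e0.
have /cvgrPdist_lt/(_ _ e0)[N _ HN] := geo (2 * K * expR (a * `|t|)).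
exists (Z N t); exists N => // n /= Nn.
rewrite -ball_normE/= distrC -(subnK Nn); apply: le_lt_trans (Ztail _ _ _) _.
have := HN N (leqnn N); rewrite sub0r normrN; apply: le_lt_trans.
by rewrite mulrAC ler_norm.
Qed.

Let X (t : R) : E := lim ((fun n => Z n t) @ \oo).

Let Xtail n (t : R) : `|X t - Z n t| <= 2 * K * (1 / 2) ^+ n * expR (a * `|t|).
Proof.
have /cvg_norm : (fun m => Z m t - Z n t) @ \oo --> X t - Z n t.
  by apply: cvgB; [exact: Zcvg|exact: cvg_cst].
move=> /cvgr_to_le; apply; exists n => // m /= nm.
by rewrite -(subnK nm).
Qed.

(** From the first iterate on, all coordinates are [M]-Lipschitz in time, and this passes to the
    pointwise limit. *)
Let Xc : continuous X.
Proof.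
move=> t; apply: continuous_row => i; apply/cvgrPdist_le => e e0.
have Kp : 0 < M + 1 by have := M0 i; lra.
near=> s; apply: (@le_trans _ _ (M * `|t - s|)); last first.
  apply: (@le_trans _ _ ((M + 1) * `|t - s|)); first by rewrite ler_wpM2r// lerDl.
  rewrite mulrC -ler_pdivlMr//; near: s.
  by apply: (@cvgr_dist_le _ R _ _ _ id t) => //; rewrite divr_gt0.
have cc (r : R) : (fun n => Z n r 0 i) @ \oo --> X r 0 i.
  exact: (@cvg_comp _ _ _ (fun n => Z n r) (fun y : E => y 0 i) _ (nbhs (X r)) _
    (@Zcvg r) (@coord_continuous R 1 d 0 i (X r))).
have /cvg_norm : (fun m => Z m t 0 i - Z m s 0 i) @ \oo --> X t 0 i - X s 0 i.
  by apply: cvgB.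
move=> /cvgr_to_le; apply; exists 1%N => // -[//|m] _ /=.
exact: step_lip.
Unshelve. all: by end_near. Qed.

Let Xfix (t : R) : X t = step X t.
Proof.
apply/eqP; rewrite -subr_eq0 -normr_le0.
have H n : `|X t - step X t| <= 2 * (2 * K) * expR (a * `|t|) * (1 / 2) ^+ n.
  have K0 : 0 <= K by rewrite le_max lexx orbT.
  rewrite -(subrKA (Z n.+1 t)); apply: le_trans (ler_normD _ _) _.
  have Kn : 0 <= 2 * K * (1 / 2) ^+ n by rewrite mulr_ge0 ?exprn_ge0 ?mulr_ge0.
  have XZ s : `|Z n s - X s| <= 2 * K * (1 / 2) ^+ n * expR (a * `|s|).
    by rewrite distrC; exact: Xtail.
  apply: le_trans (lerD (Xtail _ _) (step_contr t Kn (@Zc n) Xc XZ)) _.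
  rewrite exprS; have := expR_ge0 (a * `|t|). set u := expR _; set w := _ ^+ n.
  move=> u0; have w0 : 0 <= w by rewrite exprn_ge0.
  by have := mulr_ge0 (mulr_ge0 K0 u0) w0; lra.
have := geo (2 * (2 * K) * expR (a * `|t|)).
by move=> /cvgr_to_ge; apply; exists 0%N.
Qed.

Lemma flow_curve_ex : {X : R -> E | X 0 = x &
  forall (t : R) i, is_derive t (1 : R) (fun s => X s 0 i) (v (X t) 0 i)}.
Proof.
exists X.
  rewrite Xfix; apply/rowP => i; rewrite mxE prim0 ?addr0//; exact: v_cont.
move=> t i; rewrite (_ : (fun s => X s 0 i) = fun s => step X s 0 i).
  exact: step_derive.
by apply/funext => s; rewrite -Xfix.
Qed.

End Flow.

(** * Euclidean norm, test functions and integral curves *)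

Section EuclideanNorm.
Context {R : realType} {d : nat}.
Local Notation E := 'rV[R]_d.
Implicit Types x y u v : E.

Lemma dot_ge0 x : 0 <= dot x x.
Proof. by apply: sumr_ge0 => i _; rewrite -expr2 sqr_ge0. Qed.

Lemma enorm_ge0 x : 0 <= enorm x. Proof. exact: sqrtr_ge0. Qed.

Lemma enorm_sqr x : enorm x ^+ 2 = dot x x.
Proof. by rewrite sqr_sqrtr// dot_ge0. Qed.

Lemma coord_le_enorm x i : `|x 0 i| <= enorm x.
Proof.
rewrite -(ler_pXn2r (n := 2))// ?nnegrE ?enorm_ge0// enorm_sqr real_normK ?num_real//.
rewrite /dot (bigD1 i)//= -expr2 lerDl; apply: sumr_ge0 => j _.
by rewrite -expr2 sqr_ge0.
Qed.

Lemma norm_le_enorm x : `|x| <= enorm x.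
Proof. by apply: row_norm_le => [|i]; [exact: enorm_ge0|exact: coord_le_enorm]. Qed.

(** The factor [d], in place of the sharp [sqrt d], rests on [d <= d^2] for natural numbers and
    keeps roots out of later constants. *)
Lemma enorm_le x (A : R) : 0 <= A -> (forall i, `|x 0 i| <= A) -> enorm x <= d%:R * A.
Proof.
move=> A0 xA; rewrite -(ler_pXn2r (n := 2))// ?nnegrE ?enorm_ge0 ?mulr_ge0//.
rewrite enorm_sqr exprMn; apply: (@le_trans _ _ (\sum_(i < d) A ^+ 2)).
  apply: ler_sum => i _; rewrite -expr2 -[x 0 i ^+ 2]real_normK ?num_real//.
  by rewrite ler_pXn2r// nnegrE.
rewrite sumr_const card_ord -[A ^+ 2 *+ d]mulr_natl ler_wpM2r ?sqr_ge0//.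
by rewrite -natrX ler_nat; case: (d) => // n; rewrite expnS leq_pmulr// expn_gt0.
Qed.

Lemma enorm_le_norm x : enorm x <= d%:R * `|x|.
Proof. by apply: enorm_le => // i; exact: coord_le_norm. Qed.

Lemma enorm_gt0 x : x != 0 -> 0 < enorm x.
Proof. by move=> x0; apply: lt_le_trans (norm_le_enorm x); rewrite normr_gt0. Qed.

(** Turns a coordinatewise Lipschitz bound into the two-sided bound that drives both [gronwall] and
    the barriers. *)
Lemma dot_le_Lipschitz (v : E -> E) (L : R) :
  (forall x y i, `|v x 0 i - v y 0 i| <= L * `|x - y|) ->
  forall x y, `|dot (x - y) (v x - v y)| <= d%:R * L * dot (x - y) (x - y).
Proof.
move=> vL x y; apply: le_trans (ler_norm_sum _ _ _) _.
apply: (@le_trans _ _ (\sum_(i < d) L * dot (x - y) (x - y))); last first.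
  by rewrite sumr_const card_ord -mulrA mulr_natl.
apply: ler_sum => i _; rewrite normrM mulrC -enorm_sqr expr2 mulrA.
apply: ler_pM => //; last exact: coord_le_enorm.
rewrite [X in `|X|](_ : _ = v x 0 i - v y 0 i); last by rewrite !mxE.
(* A negative [L] is consistent only with [x = y], where both sides vanish. *)
have [L0|L0] := leP 0 L.
  by apply: le_trans (vL x y i) _; rewrite ler_wpM2l// norm_le_enorm.
have [->|xy] := eqVneq x y.
  by rewrite !subrr normr0 /enorm /dot big1 ?sqrtr0 ?mulr0// => j _; rewrite mxE mul0r.
have := le_trans (normr_ge0 _) (vL x y i).
by rewrite nmulr_rge0// normr_le0 subr_eq0 (negbTE xy).
Qed.

Lemma W1inf_le (theta : E -> E) (A B : R) : 0 <= A -> 0 <= B ->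
  (forall x i, `|theta x 0 i| <= A) ->
  (forall x y i, `|theta x 0 i - theta y 0 i| <= B * enorm (x - y)) ->
  W1inf theta /\ W1inf_norm theta <= d%:R * (A + B).
Proof.
move=> A0 B0 tA tB.
have A' x : enorm (theta x) <= d%:R * A by exact: enorm_le.
have B' x y : enorm (theta x - theta y) <= d%:R * B * enorm (x - y).
  rewrite -mulrA; apply: enorm_le => [|i]; first by rewrite mulr_ge0 ?enorm_ge0.
  by rewrite !mxE.
(* In dimension 0 there are no distinct points; the set of difference quotients is then empty and
   its [sup] is 0 by convention. *)
have sup_le (S : set R) (C : R) : 0 <= C -> (forall r, S r -> r <= C) -> sup S <= C.
  move=> C0 SC; have [->|/set0P S0] := eqVneq S set0; first by rewrite sup0.
  exact: ge_sup.
split; first by split; [exists (d%:R * A)|exists (d%:R * B)].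
rewrite mulrDr lerD//; apply: sup_le; rewrite ?mulr_ge0//.
  by move=> _ [x _ <-].
move=> _ [[x y] /= xy <-]; rewrite ler_pdivrMr ?B'// enorm_gt0// subr_eq0.
exact/eqP.
Qed.

End EuclideanNorm.

Section CompactSupport.
Context {R : realType} {d : nat}.
Local Notation E := 'rV[R]_d.
Implicit Types f : E -> R.

Lemma notin_fsupp {V : normedModType R} (f : V -> R) x : ~ fsupp f x -> f x = 0.
Proof.
by move=> nx; apply: contrapT => fx; apply: nx; apply: subset_closure; apply/eqP.
Qed.

Lemma fsupp_sub {V : normedModType R} (f g : V -> R) :
  (forall x, ~ fsupp f x -> g x = 0) -> fsupp g `<=` fsupp f.
Proof.
move=> fg; rewrite [X in _ `<=` X]((closure_id (fsupp f)).1 _); last exact: closed_closure.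
apply: closureS.
by move=> x /= gx; apply: contrapT => nx; move/eqP: gx; apply; exact: fg.
Qed.

Lemma derive_notin_fsupp {V : normedModType R} (f : V -> R) v x : ~ fsupp f x -> 'D_v f x = 0.
Proof.
move=> nx; rewrite (@near_eq_derive _ _ _ _ (cst 0)) ?derive_cst//.
have : open (~` fsupp f) by apply: closed_openC; exact: closed_closure.
rewrite openE => /(_ x nx); apply: filterS => y ny; exact: notin_fsupp.
Qed.

Lemma compact_fsupp_sub f g : compact (fsupp f) ->
  (forall x, ~ fsupp f x -> g x = 0) -> compact (fsupp g).
Proof.
move=> cf fg; apply: subclosed_compact cf _; first exact: closed_closure.
exact: fsupp_sub.
Qed.

Lemma compact_supp_bounded f : continuous f -> compact (fsupp f) ->
  exists2 M, 0 <= M & forall x, `|f x| <= M.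
Proof.
move=> cf Cf.
have /compact_bounded[M [_ HM]] : compact (f @` fsupp f).
  by apply: continuous_compact => //; exact: continuous_subspaceT.
exists (`|M| + 1) => [|x]; first by rewrite addr_ge0.
have [fx|nfx] := pselect (fsupp f x); last by rewrite (notin_fsupp nfx) normr0 addr_ge0.
apply: HM; last by exists x.
by rewrite (le_lt_trans (ler_norm M))// ltrDl.
Qed.

Lemma is_derive_segment f (x u : E) (t : R) : (forall y, differentiable f y) ->
  is_derive t (1 : R) (fun s : R => f (s *: u + x)) ('D_u f (t *: u + x)).
Proof.
move=> df; apply/(is_derive_line (fun s : R => f (s *: u + x))).
have /is_derive_line : is_derive (t *: u + x) u f ('D_u f (t *: u + x)).
  by apply: derivableP; exact: diff_derivable.
congr (is_derive _ _ _ _); apply/funext => h.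
by rewrite addrA -scalerDl [h *: 1]mulr1.
Qed.

Lemma compact_supp_Lipschitz f : Ck 1 f -> compact (fsupp f) ->
  exists2 L, 0 <= L & forall x y, `|f x - f y| <= L * `|x - y|.
Proof.
move=> [df Df] Cf.
have /choice[M HM] i : exists M, forall x, `|'D_(delta_mx 0 i) f x| <= M.
  have [||M _ HM] := @compact_supp_bounded ('D_(delta_mx 0 i) f).
  - exact: Df.
  - by apply: compact_fsupp_sub Cf _ => x; exact: derive_notin_fsupp.
  - by exists M.
have M0 i : 0 <= M i by apply: le_trans (HM i 0).
exists (\sum_i M i) => [|x y]; first by apply: sumr_ge0 => i _; exact: M0.
have := @derive_le _ (fun s : R => f (s *: (x - y) + y)) _ ((\sum_i M i) * `|x - y|) 0 1 ler01
  (fun s _ => is_derive_segment y (x - y) s df).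
rewrite scale1r scale0r add0r subrK subr0 mulr1; apply=> t _.
rewrite derive_row//; apply: le_trans (ler_norm_sum _ _ _) _; rewrite mulr_suml.
apply: ler_sum => i _; rewrite normrM mulrC; apply: ler_pM => //; exact: coord_le_norm.
Qed.

End CompactSupport.

(** * Integral curves: Gronwall's inequality, uniqueness, Taylor estimate *)

Section IntegralCurves.
Context {R : realType} {d : nat}.
Local Notation E := 'rV[R]_d.
Implicit Types (v : E -> E) (U V : R -> E).

Definition integral_curve v U :=
  forall (t : R) i, is_derive t (1 : R) (fun s => U s 0 i) (v (U t) 0 i).

Lemma integral_curve_opp v U : integral_curve v U ->
  integral_curve (fun x => - v x) (fun t => U (- t)).
Proof.
move=> cU t i; rewrite mxE.
exact: (@is_derive_comp_opp _ (fun s => U s 0 i)).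
Qed.

Lemma integral_curve_shift v U (a : R) : integral_curve v U ->
  integral_curve v (fun t => U (t + a)).
Proof.
move=> cU t i; rewrite -[v _ 0 i]mulr1.
apply: (@is_derive_comp1 _ _ (fun s => U s 0 i) (fun t : R => t + a)) => //.
by have := is_deriveD_fun (is_derive_id t (1 : R)) (is_derive_cst a t 1); rewrite addr0.
Qed.

Lemma is_derive_dot v U V (t : R) : integral_curve v U -> integral_curve v V ->
  is_derive t (1 : R) (fun s => dot (U s - V s) (U s - V s))
    (2 * dot (U t - V t) (v (U t) - v (V t))).
Proof.
move=> cU cV; have D i : is_derive t (1 : R) (fun s => (U s - V s) 0 i) ((v (U t) - v (V t)) 0 i).
  rewrite (_ : (fun s => _) = (fun s => U s 0 i - V s 0 i)).
    by rewrite !mxE; apply: is_deriveB_fun; [exact: cU|exact: cV].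
  by apply/funext => s; rewrite !mxE.
have := is_derive_sum_fun (fun i => is_deriveM_fun (D i) (D i)).
rewrite /dot mulr_sumr; set a := (X in is_derive _ _ _ X); set b := (X in _ -> is_derive _ _ _ X).
suff -> : a = b by [].
by apply: eq_bigr => i _; rewrite mulr2n mulrDl !mul1r.
Qed.

Lemma is_derive_expR_lin (c t : R) :
  is_derive t (1 : R) (fun s : R => expR (c * s)) (expR (c * t) * c).
Proof.
apply: (@is_derive_comp1 _ _ expR (fun s : R => c * s)).
by have := is_deriveM_fun (is_derive_cst c t 1) (is_derive_id t 1); rewrite mulr0 addr0 mulr1.
Qed.

(** For [t >= 0], [e^(-2Kt) |U t - V t|^2] is nonincreasing. Negative times reduce to this case
    because the bound on [v] is two-sided, hence inherited by [- v], whose integral curves are the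
    reversed ones. *)
Lemma gronwall v (K : R) U V (t : R) :
  (forall x y, `|dot (x - y) (v x - v y)| <= K * dot (x - y) (x - y)) ->
  integral_curve v U -> integral_curve v V ->
  dot (U t - V t) (U t - V t) <= expR (2 * K * `|t|) * dot (U 0 - V 0) (U 0 - V 0).
Proof.
wlog t0 : v U V t / 0 <= t.
  move=> H vK cU cV; have [t0|t0] := leP 0 t; first exact: (H v).
  have := H (fun x => - v x) (fun s => U (- s)) (fun s => V (- s)) (- t).
  rewrite opprK oppr0 oppr_ge0 normrN; apply;
    [exact: ltW| |exact: integral_curve_opp|exact: integral_curve_opp].
  move=> x y; rewrite -opprD (_ : dot _ (- _) = - dot (x - y) (v x - v y)) ?normrN//.
  by rewrite /dot -sumrN; apply: eq_bigr => i _; rewrite -mulrN !mxE.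
move=> vK cU cV; rewrite (ger0_norm t0).
pose q s := dot (U s - V s) (U s - V s).
have Dq (s : R) := is_deriveM_fun (is_derive_expR_lin (- (2 * K)) s) (is_derive_dot s cU cV).
have := ge0_derive_le t0 (fun s _ => is_deriveN_fun (Dq s)).
rewrite mulr0 expR0 mul1r lerN2 mulNr expRN -/(q t) -/(q 0) => H.
suff : (expR (2 * K * t))^-1 * q t <= q 0.
  by rewrite mulrC ler_pdivrMr ?expR_gt0// mulrC.
apply: H => s _; rewrite -/(q s); set e := expR _; set D := dot _ (v _ - _).
rewrite [leRHS](_ : _ = 2 * e * (K * q s - D)); last by ring.
rewrite !mulr_ge0 ?expR_ge0// subr_ge0; apply: le_trans (vK _ _); exact: ler_norm.
Qed.

Lemma integral_curve_unique v (K : R) U V :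
  (forall x y, `|dot (x - y) (v x - v y)| <= K * dot (x - y) (x - y)) ->
  integral_curve v U -> integral_curve v V -> U 0 = V 0 -> U =1 V.
Proof.
move=> vK cU cV UV t; have := gronwall t vK cU cV.
have dot0 : dot (0 : E) 0 = 0 by rewrite /dot big1// => i _; rewrite mxE mul0r.
rewrite UV subrr dot0 mulr0 -enorm_sqr => H.
apply/eqP; rewrite -subr_eq0; apply: contraTT isT => /enorm_gt0 e0.
by move: H; rewrite leNgt exprn_gt0.
Qed.

Lemma is_derive_along v U (f : E -> R) (t : R) : (forall x, differentiable f x) ->
  integral_curve v U ->
  is_derive t (1 : R) (fun s => f (U s)) (\sum_j v (U t) 0 j * 'D_(delta_mx 0 j) f (U t)).
Proof.
move=> df cU; have dU : differentiable U t.
  apply: differentiable_row => i; apply/derivable1_diffP.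
  by have [] := cU t i.
apply: DeriveDef; first by apply/derivable1_diffP; exact: differentiable_comp.
rewrite deriveE; last exact: differentiable_comp.
rewrite diff_comp//= -(deriveE (1 : R) dU) -deriveE// derive_row//; apply: eq_bigr => i _.
rewrite derive_mx ?mxE; last exact: diff_derivable.
by congr (_ * _); have [_ ] := cU t i.
Qed.

(** Two uses of the mean value inequality give the constant [Q] in place of the sharp [Q / 2]. *)
Lemma taylor2_le (F F' F'' : R -> R) (Q t : R) : 0 <= t ->
  (forall s : R, is_derive s (1 : R) F (F' s)) ->
  (forall s : R, is_derive s (1 : R) F' (F'' s)) ->
  (forall s, 0 <= s <= t -> `|F'' s| <= Q) ->
  `|F t - F 0 - t * F' 0| <= Q * t ^+ 2.
Proof.
move=> t0 DF DF' FQ.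
have Q0 : 0 <= Q by apply: le_trans (FQ 0 _); rewrite ?lexx.
have H1 s : 0 <= s <= t -> `|F' s - F' 0| <= Q * t.
  move=> /andP[s0 st]; apply: le_trans (_ : Q * (s - 0) <= _); last by rewrite subr0 ler_wpM2l.
  apply: (derive_le s0 (fun s _ => DF' s)) => r /andP[r0 rs].
  by apply: FQ; rewrite r0 (le_trans rs).
have D (s : R) : is_derive s (1 : R) (fun s => F s - s * F' 0) (F' s - F' 0).
  have := is_deriveM_fun (is_derive_id s (1 : R)) (is_derive_cst (F' 0) s 1).
  by rewrite mulr0 add0r mulr1 => H; exact: (is_deriveB_fun (DF s) H).
have := derive_le t0 (fun s _ => D s) H1.
by rewrite subr0 mul0r subr0 addrAC expr2 mulrA.
Qed.

End IntegralCurves.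

Section FlowOfField.
Context {R : realType} {d : nat}.
Local Notation E := 'rV[R]_d.
Variables (v : E -> E) (X : E -> R -> E) (K : R).
Hypothesis vK : forall x y, `|dot (x - y) (v x - v y)| <= K * dot (x - y) (x - y).
Hypothesis X0 : forall x, X x 0 = x.
Hypothesis Xcurve : forall x, integral_curve v (X x).

(** [X (X y (- t))] and [s |-> X y (s - t)] are integral curves with the same starting point;
    uniqueness identifies them at time [t]. *)
Lemma flow_inv t y : X (X y (- t)) t = y.
Proof.
rewrite (integral_curve_unique (U := X (X y (- t))) (V := fun s => X y (s - t)) vK) ?subrr//.
- exact: integral_curve_shift.
- by rewrite X0 sub0r.
Qed.

Lemma flow_enorm_le t x y : enorm (X x t - X y t) <= expR (K * `|t|) * enorm (x - y).
Proof.
rewrite -(ler_pXn2r (n := 2))// ?nnegrE ?enorm_ge0 ?mulr_ge0 ?expR_ge0 ?enorm_ge0//.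
rewrite exprMn !enorm_sqr -expRM_natl mulrA.
by have := gronwall t vK (Xcurve x) (Xcurve y); rewrite !X0.
Qed.

Lemma flow_continuous t : continuous (fun x => X x t).
Proof.
move=> x; apply/(@cvgrPdist_le _ _ _ (nbhs (x : E)) (nbhs_filter x) (fun x => X x t)) => e e0.
set C := expR (K * `|t|) * d%:R.
have C0 : 0 < C + 1 by rewrite ltr_wpDl// mulr_ge0 ?expR_ge0.
near=> y.
apply: le_trans (norm_le_enorm _) _; apply: le_trans (flow_enorm_le _ _ _) _.
apply: le_trans (ler_wpM2l (expR_ge0 _) (enorm_le_norm _)) _.
rewrite mulrA -/C; apply: (@le_trans _ _ ((C + 1) * `|x - y|)).
  by rewrite ler_wpM2r// lerDl.
rewrite mulrC -ler_pdivlMr//; near: y.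
exact: ((@cvgrPdist_le _ _ _ _ (nbhs_filter x) (id : E -> E) x).1 (@cvg_id _ _) _ (divr_gt0 e0 C0)).
Unshelve. all: by end_near. Qed.

End FlowOfField.

(** * Weakly nondecreasing functions *)

Section WeakMonotone.
Context {R : realType}.

(** Composition with this retraction onto [[0, T]] extends a function continuous on the interval to
    the whole line, where [primitive_ex] applies. *)
Definition clamp (T t : R) : R := Num.max 0 (Num.min t T).

Lemma clamp_in T t : 0 <= T -> clamp T t \in `[0, T].
Proof. by move=> T0; rewrite in_itv/= /clamp le_max lexx/= ge_max T0 ge_min lexx orbT. Qed.

Lemma clamp_id T t : t \in `[0, T] -> clamp T t = t.
Proof. by rewrite in_itv/= /clamp => /andP[t0 tT]; rewrite min_l// max_r. Qed.

Lemma clamp_continuous T : continuous (clamp T).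
Proof.
move=> t; apply: (@continuous_max _ _ (fun=> 0) (fun s => Num.min s T)).
  exact: cvg_cst.
by apply: (@continuous_min _ _ id (fun=> T)); [exact: cvg_id|exact: cvg_cst].
Qed.

Definition continuous_on (T : R) (f : R -> R) :=
  forall t : R, t \in `[0, T] -> f s @[s --> within `[0, T] (nbhs t)] --> f t.

Lemma continuous_on_ball (T : R) (f : R -> R) (t e : R) :
  continuous_on T f -> t \in `[0, T] -> 0 < e ->
  exists2 r : R, 0 < r & forall s, 0 <= s <= T -> `|t - s| < r -> `|f t - f s| < e.
Proof.
move=> cf tT e0; have /cvgrPdist_lt/(_ _ e0) := cf t tT.
rewrite near_withinE => /nbhs_ballP[r r0 Hr]; exists r => // s sT ts.
by apply: Hr.
Qed.

Lemma continuous_clamp (T : R) (f : R -> R) :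
  0 <= T -> continuous_on T f -> continuous (f \o clamp T).
Proof.
move=> T0 cf t; apply: cvg_comp (cf _ (clamp_in t T0)).
move=> A /= hA; have := clamp_continuous hA; rewrite /= !nbhs_simpl/=.
by apply: filterS => s; apply; exact: clamp_in.
Qed.

Lemma integral_oo_primitive (T : R) (f P : R -> R) : 0 < T -> continuous_on T f ->
  (forall t : R, is_derive t (1 : R) P ((f \o clamp T) t)) ->
  (\int[lebesgue_measure]_(t in `]0%R, T[) (f t)%:E = (P T - P 0)%:E)%E.
Proof.
move=> T0 cf DP.
have cft := continuous_clamp (ltW T0) cf.
rewrite EFinB -(@continuous_FTC2 R (f \o clamp T) P 0 T T0); last 1 first.
- by move=> t _; rewrite derive1E; have [] := DP t.
- rewrite integral_itv_bndoo.
    apply: eq_integral => t; rewrite inE/= in_itv/= => /andP[t0 tT].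
    by rewrite clamp_id// in_itv/= !ltW.
  apply/measurable_EFinP; apply: measurable_funS measurableT _ _ => //.
  exact: continuous_measurable_fun.
- exact: continuous_subspaceT.
- have Pc (t : R) : P @ t --> P t := is_derive_continuous (DP t).
  split; first by move=> t _; have [] := DP t.
    exact: cvg_at_right_filter.
  exact: cvg_at_left_filter.
Qed.

Lemma constant_derive0 (N : R -> R) (T t D : R) : 0 < t < T ->
  (forall s, 0 <= s <= T -> N s = N 0) -> is_derive t (1 : R) N D -> D = 0.
Proof.
move=> /andP[t0 tT] Nc [_ <-].
rewrite (@near_eq_derive _ _ _ _ (cst (N 0))) ?derive_cst//.
near=> s; apply: Nc; apply/andP; split; apply: ltW; near: s.
  exact: lt_nbhsr.
exact: lt_nbhsl.
Unshelve. all: by end_near. Qed.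

Definition hump (e : R) (r : R) := flat 0 r * flat 0 (e - r).

Lemma Ck_id (k : nat) : Ck k (id : R -> R).
Proof.
case: k => [|k]; first by move=> x; exact: cvg_id.
by apply: (@Ck_derive1 _ _ _ (fun=> 1)); exact: Ck_cst.
Qed.

Lemma hump_smooth e k : Ck k (hump e).
Proof.
apply: CkM; first exact: flat_smooth.
apply: (@Ck_comp1 _ _ _ (flat 0) (fun r => e - r)); first exact: flat_smooth.
have := CkD (Ck_cst k e) (CkM (Ck_cst k (-1)) (Ck_id k)).
by congr Ck; apply/funext => r; rewrite mulN1r.
Qed.

Lemma hump_ge0 e r : 0 <= hump e r.
Proof. by rewrite mulr_ge0 ?flat_ge0. Qed.

Lemma hump_eq0 e r : ~~ (0 < r < e) -> hump e r = 0.
Proof.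
rewrite negb_and -!leNgt => /orP[r0|er]; rewrite /hump.
  by rewrite flat_neg ?mul0r.
by rewrite [X in _ * X]flat_neg ?mulr0// subr_le0.
Qed.

Lemma hump_gt0 e r : 0 < r < e -> 0 < hump e r.
Proof. by move=> /andP[r0 re]; rewrite mulr_gt0 ?flat_gt0 ?subr_gt0. Qed.

(* The hypothesis says that the distributional derivative of [G] is nonnegative. It is tested on
   the difference of two translates of a primitive of [hump]. *)
Lemma weak_nondecreasing (T : R) (G : R -> R) : continuous_on T G ->
  (forall (chi dchi : R -> R) (a b : R), 0 < a -> b < T ->
    smooth chi -> (forall t : R, is_derive t (1 : R) chi (dchi t)) -> continuous dchi ->
    (forall t, 0 <= chi t) -> (forall t, chi t != 0 -> a <= t <= b) ->
    exists2 Phi : R -> R, continuous_on T Phi /\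
      (\int[lebesgue_measure]_(t in `]0%R, T[) (Phi t)%:E = 0)%E &
      forall t, 0 <= t <= T -> dchi t * G t <= Phi t) ->
  forall a b, 0 < a -> a < b -> b < T -> G a <= G b.
Proof.
move=> cG H a b a0 ab bT; rewrite leNgt; apply/negP => Gba.
(* If [G b < G a], the level [m] separates the two values: [G] exceeds [m] near [a] and stays below
   it near [b]. *)
pose m := (G a + G b) / 2.
have [e1 e10 He1] : exists2 e : R, 0 < e & forall s, 0 <= s <= T -> `|a - s| < e -> m < G s.
  have aT : a \in `[0, T] by rewrite in_itv/= !ltW// (lt_trans ab).
  have [|e e0 He] := continuous_on_ball cG aT (e := G a - m); first by rewrite /m; lra.
  by exists e => // s sT /(He s sT); rewrite ltr_norml => /andP[]; lra.
have [e2 e20 He2] : exists2 e : R, 0 < e & forall s, 0 <= s <= T -> `|b - s| < e -> G s < m.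
  have bT' : b \in `[0, T] by rewrite in_itv/= !ltW// (lt_trans a0).
  have [|e e0 He] := continuous_on_ball cG bT' (e := m - G b); first by rewrite /m; lra.
  by exists e => // s sT /(He s sT); rewrite ltr_norml => /andP[]; lra.
have [e e0 [ee1 ee2 eb eT]] : exists2 e : R, 0 < e & [/\ e < e1, e < e2, a + e < b & b + e < T].
  exists (Num.min (Num.min e1 e2) (Num.min (b - a) (T - b)) / 2).
    by rewrite divr_gt0// !lt_min e10 e20 !subr_gt0 ab bT.
  set x := Num.min _ _.
  have : 0 < x by rewrite !lt_min e10 e20 !subr_gt0 ab bT.
  have : x <= e1 by rewrite !ge_min lexx.
  have : x <= e2 by rewrite !ge_min lexx orbT.
  have : x <= b - a by rewrite !ge_min lexx !orbT.
  have : x <= T - b by rewrite !ge_min lexx !orbT.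
  by move=> *; split; lra.
have [S S0 DS] := primitive_ex (Ck_continuous (hump_smooth e 0)).
have Smono r s : r <= s -> S r <= S s.
  by move=> rs; apply: (ge0_derive_le rs (fun t _ => DS t)) => t _; exact: hump_ge0.
have Sconst r s : r <= s -> (forall t, r <= t <= s -> hump e t = 0) -> S r = S s.
  move=> rs Z; have := derive_le rs (fun t _ => DS t) (M := 0).
  rewrite mul0r normr_le0 subr_eq0 => Hz; apply/esym/eqP/Hz => t /Z ->.
  by rewrite normr0.
have Sneg r : r <= 0 -> S r = 0.
  move=> r0; rewrite -S0; apply: Sconst => // t /andP[_ t0].
  by rewrite hump_eq0// ltNge t0.
have Spos r : e <= r -> S r = S e.
  move=> r0; apply/esym/Sconst => // t /andP[t0 _].
  by rewrite hump_eq0// negb_and -!leNgt t0 orbT.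
(* [chi] rises from 0 to [S e] on [[a, a + e]], is constant up to [b], and falls back to 0 on
   [[b, b + e]]. *)
pose chi t := S (t - a) - S (t - b).
pose dchi t := hump e (t - a) - hump e (t - b).
have Dsh c (t : R) (F F' : R -> R) : (forall t : R, is_derive t (1 : R) F (F' t)) ->
    is_derive t (1 : R) (fun s => F (s - c)) (F' (t - c)).
  move=> DF; rewrite -[F' _]mulr1; apply: (@is_derive_comp1 _ _ F (fun s : R => s - c)) => //.
  by have := is_deriveB_fun (is_derive_id t (1 : R)) (is_derive_cst c t 1); rewrite subr0.
have Csh c k (F : R -> R) : Ck k F -> Ck k (fun s => F (s - c)).
  move=> CF; apply: (@Ck_comp1 _ _ _ F (fun s => s - c)) => //.
  exact: CkD (Ck_id k) (Ck_cst k (- c)).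
have DC (t : R) : is_derive t (1 : R) chi (dchi t).
  by apply: is_deriveB_fun; exact: Dsh.
have smB k (F F' : R -> R) : Ck k F -> Ck k F' -> Ck k (fun s => F s - F' s).
  move=> CF CF'; have := CkD CF (CkM (Ck_cst k (-1)) CF').
  by congr Ck; apply/funext => s; rewrite mulN1r.
have smS k : Ck k S by apply: CkS; apply: Ck_derive1 DS _; exact: hump_smooth.
have dchi_cont : continuous dchi.
  by apply: (@Ck_continuous _ _ 0); apply: smB; apply: Csh; exact: hump_smooth.
have chi0 t : 0 <= chi t by rewrite subr_ge0 Smono// lerB// ltW.
have chi_supp t : chi t != 0 -> a <= t <= b + e.
  apply: contraNT; rewrite negb_and -!ltNge => /orP[ta|bt]; apply/eqP; rewrite /chi.
    by rewrite !Sneg ?subrr//; lra.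
  by rewrite !Spos ?subrr//; lra.
have chi_smooth : smooth chi by move=> k; apply: smB; apply: Csh.
have [Phi [cPhi intPhi] HPhi] := H chi dchi a (b + e) a0 eT chi_smooth DC dchi_cont chi0 chi_supp.
have T0 : 0 < T by lra.
have [P P0 DP] := primitive_ex (continuous_clamp (ltW T0) cPhi).
have PT : P T = P 0.
  have := integral_oo_primitive T0 cPhi DP; rewrite intPhi => -[] /esym/eqP.
  by rewrite subr_eq0 => /eqP.
(* As [chi] vanishes at 0 and [T], the end values of [N] agree. Its derivative is at least
   [dchi t * (G t - m)], which is nonnegative because each hump sits where [G - m] has the matching
   sign. So [N] is constant, against its positive derivative at the midpoint of the first hump. *)
pose N t := P t - m * chi t.
have DN (t : R) : is_derive t (1 : R) N ((Phi \o clamp T) t - m * dchi t).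
  have := is_deriveM_fun (is_derive_cst m t 1) (DC t).
  by rewrite mulr0 addr0 => H1; exact: (is_deriveB_fun (DP t) H1).
have DNge t : 0 <= t <= T -> dchi t * (G t - m) <= (Phi \o clamp T) t - m * dchi t.
  by move=> tT; rewrite /= clamp_id// mulrBr [m * _]mulrC lerB// HPhi.
have dG t : 0 <= t <= T -> 0 <= dchi t * (G t - m).
  move=> tT; rewrite /dchi.
  have [ta|ta] := boolP (0 < t - a < e).
    have -> : hump e (t - b) = 0 by rewrite hump_eq0//; lra.
    by rewrite subr0 mulr_ge0 ?hump_ge0// subr_ge0 ltW// He1// ltr_norml; lra.
  rewrite (hump_eq0 ta) sub0r.
  have [tb|tb] := boolP (0 < t - b < e); last by rewrite (hump_eq0 tb) oppr0 mul0r.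
  rewrite mulNr -mulrN mulr_ge0 ?hump_ge0// oppr_ge0 subr_le0 ltW// He2//.
  by clear ta; rewrite distrC ltr_norml; lra.
have N0T s : 0 <= s <= T -> N s = N 0.
  move=> /andP[s0 sT]; apply/eqP; rewrite eq_le; apply/andP; split.
    have -> : N 0 = N T.
      rewrite /N PT; congr (_ - _ * _); rewrite /chi.
      by rewrite (Sneg (0 - a)) ?(Sneg (0 - b)) ?(Spos (T - a)) ?(Spos (T - b)) ?subrr//; lra.
    apply: (ge0_derive_le sT (fun t _ => DN t)) => t /andP[st tT].
    by apply: le_trans (DNge _ _); [apply: dG|]; lra.
  apply: (ge0_derive_le s0 (fun t _ => DN t)) => t /andP[st tT].
  by apply: le_trans (DNge _ _); [apply: dG|]; lra.
have t0T : 0 < a + e / 2 < T by lra.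
have := constant_derive0 t0T N0T (DN _).
apply/eqP; rewrite gt_eqF//; apply: lt_le_trans (DNge _ _); last by lra.
rewrite /dchi (@hump_eq0 _ (a + e / 2 - b)); last by lra.
rewrite subr0 mulr_gt0 ?hump_gt0 ?subr_gt0//; first by lra.
by apply: He1; [lra|rewrite ltr_norml; lra].
Qed.

End WeakMonotone.

(** * Integrals of continuous functions *)

Section BoundedContinuous.
Context {R : realType} {d : nat}.
Local Notation E := 'rV[R]_d.
Local Notation prob := (probability (borelRV R d) R).
Implicit Types (mu : prob) (f g : E -> R).

Lemma open_measurable_borelRV (U : set E) : open U -> measurable (U : set (borelRV R d)).
Proof. by move=> oU; exact: sub_sigma_algebra. Qed.

Lemma continuous_measurable_borelRV f : continuous f ->
  measurable_fun [set: borelRV R d] (f : borelRV R d -> R).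
Proof.
move=> cf; apply: (measurability _ (RGenOInfty.measurableE R)).
move=> _ [_ [x ->] <-]; rewrite setTI; apply: open_measurable_borelRV.
apply: open_comp; first by move=> y _; exact: cf.
by rewrite set_itvE; exact: open_gt.
Qed.

Lemma bounded_continuous_integrable mu f (M : R) : continuous f -> (forall x, `|f x| <= M) ->
  mu.-integrable setT (EFin \o (f : borelRV R d -> R)).
Proof.
move=> cf fM; apply: measurable_bounded_integrable => //.
- by apply: (le_lt_trans (probability_le1 _ _)) => //; rewrite ltry.
- exact: continuous_measurable_borelRV.
- exists M; split; first exact: num_real.
  by move=> y My x _; apply: le_trans (fM x) _; exact: ltW.
Qed.

Lemma Rintegral_dist_le mu f g (M e : R) : continuous f -> continuous g ->
  (forall x, `|f x| <= M) -> (forall x, `|g x| <= M) -> (forall x, `|f x - g x| <= e) ->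
  `|\int[mu]_x f x - \int[mu]_x g x| <= e.
Proof.
move=> cf cg fM gM fg.
have If := bounded_continuous_integrable mu cf fM.
have Ig := bounded_continuous_integrable mu cg gM.
rewrite -RintegralB//.
have cfg : continuous (fun x => f x - g x).
  by move=> x; exact: (cvgB (cf x) (cg x)).
apply: le_trans (le_normr_Rintegral _ _) _ => //.
  exact: (bounded_continuous_integrable mu cfg fg).
have cN : continuous (fun x => `|f x - g x|).
  by move=> x; exact: (cvg_norm (cfg x)).
apply: (@le_trans _ _ (\int[mu]_x (fun=> e) x)).
  apply: le_Rintegral => //.
  - by apply: (bounded_continuous_integrable mu cN (M := e)) => x; rewrite normr_id.
  - have cc : continuous (fun _ : E => e) by exact: cst_continuous.
    exact: (bounded_continuous_integrable mu cc (fun=> lexx `|e|)).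
have mu1 : fine (mu [set: borelRV R d]) = 1 by rewrite probability_setT.
by rewrite Rintegral_cst// mu1 mulr1.
Qed.

(** A nonnegative function has integral zero exactly when it vanishes almost everywhere. This
    converts inequalities between integrals of barriers into statements on the mass of balls. *)
Lemma Rintegral_gt0 mu f (M : R) : continuous f -> (forall x, `|f x| <= M) ->
  (forall x, 0 <= f x) ->
  (0 < \int[mu]_x f x) = (0 < mu [set x | (f x != 0)%R])%E.
Proof.
move=> cf fM f0.
have If := bounded_continuous_integrable mu cf fM.
have mf : measurable_fun setT (EFin \o (f : borelRV R d -> R)).
  by apply/measurable_EFinP; exact: continuous_measurable_borelRV.
have fE : (\int[mu]_x `|(f x)%:E| = (\int[mu]_x f x)%:E)%E.
  rewrite /Rintegral fineK ?integrable_fin_num//.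
  by apply: eq_integral => x _; rewrite gee0_abs// lee_fin.
have mN : measurable ([set x | (f x != 0)%R] : set (borelRV R d)).
  apply: open_measurable_borelRV; apply: (@open_comp _ _ f [set y | y != 0]).
    by move=> y _; exact: cf.
  exact: open_neq.
rewrite lt_neqAle Rintegral_ge0// andbT lt_neqAle measure_ge0 andbT; congr (~~ _).
apply/eqP/eqP => [I0|N0].
  have /(ae_eq_integral_abs mu measurableT mf) : (\int[mu]_x `|(f x)%:E| = 0)%E by rewrite fE -I0.
  move=> [N [mN' N0 sN]]; apply/esym/eqP; rewrite eq_le measure_ge0 andbT -N0.
  apply: le_measure; rewrite ?inE// => x /= fx; apply: sN => /= /(_ I) [] /eqP.
  by rewrite (negbTE fx).
have : (\int[mu]_x `|(f x)%:E| = 0)%E.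
  apply/(ae_eq_integral_abs mu measurableT mf).
  exists [set x | (f x != 0)%R]; split => // x /= fx; apply/eqP => fx0.
  by apply: fx => _; rewrite fx0.
by rewrite fE => -[].
Qed.

End BoundedContinuous.

(** * Smooth functions on products, smoothness of integral curves *)

Section ProductCk.
Context {R : realType} {V W : normedModType R}.

Lemma Ck_fst k (f : V -> R) : Ck k f -> Ck k (fun z : V * W => f z.1).
Proof.
have cf : continuous (fst : V * W -> V) by move=> z; exact: cvg_fst.
apply: Ck_comp_lin => [z|u z].
  exact: linear_differentiable.
rewrite deriveE; last exact: linear_differentiable.
by rewrite diff_lin.
Qed.

Lemma Ck_snd k (f : W -> R) : Ck k f -> Ck k (fun z : V * W => f z.2).
Proof.
have cf : continuous (snd : V * W -> W) by move=> z; exact: cvg_snd.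
apply: Ck_comp_lin => [z|u z].
  exact: linear_differentiable.
rewrite deriveE; last exact: linear_differentiable.
by rewrite diff_lin.
Qed.

Lemma CkN k (f : V -> R) : Ck k f -> Ck k (fun z => - f z).
Proof.
move=> Cf; have := CkM (Ck_cst k (-1)) Cf.
by congr Ck; apply/funext => z; rewrite mulN1r.
Qed.

Lemma CkB k (f g : V -> R) : Ck k f -> Ck k g -> Ck k (fun z => f z - g z).
Proof. by move=> Cf Cg; exact: CkD Cf (CkN Cg). Qed.

End ProductCk.

Lemma Ck_expR {R : realType} (k : nat) : Ck k (@expR R).
Proof.
elim: k => [|k IH]; first exact: continuous_expR.
exact: Ck_derive1 (@is_derive_expR R) IH.
Qed.

(** Bootstrap: the derivative [v (p t)] is as regular as [p] itself. *)
Lemma integral_curve_Ck {R : realType} {d : nat} (v : 'rV[R]_d -> 'rV[R]_d) (p : R -> 'rV[R]_d) :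
  (forall i, smooth (fun x => v x 0 i)) -> integral_curve v p ->
  forall k i, Ck k (fun t => p t 0 i).
Proof.
move=> vs cp; elim=> [|k IH] i.
  by move=> t; exact: is_derive_continuous (cp t i).
apply: (Ck_derive1 (fun t => cp t i)).
exact: (Ck_comp_row (vs i k) IH).
Qed.

(** * Continuity in time of integrals along a narrowly continuous curve *)

Section ParametricIntegral.
Context {R : realType} {d : nat}.
Local Notation E := 'rV[R]_d.

Lemma continuous_fix_fst (I : R * E -> R) t : continuous I -> continuous (fun x => I (t, x)).
Proof.
move=> cI x.
apply: (@continuous2_cvg _ _ _ _ (nbhs x) _ (fun=> t) id (fun a b => I (a, b))).
- rewrite (_ : (fun z => I (z.1, z.2)) = I); first exact: cI.
  by apply/funext => -[].
- exact: cvg_cst.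
- exact: cvg_id.
Qed.

Lemma compact_param_bounded (T : R) (I : R * E -> R) (K : set E) : continuous I -> compact K ->
  (forall t x, t \in `[0, T] -> ~ K x -> I (t, x) = 0) ->
  exists M, forall t x, t \in `[0, T] -> `|I (t, x)| <= M.
Proof.
move=> cI cK I0.
have /compact_bounded[M [_ HM]] : compact (I @` (`[0, T]%classic `*` K)).
  apply: continuous_compact; first exact: continuous_subspaceT.
  by apply: compact_setX => //; exact: segment_compact.
exists (`|M| + 1) => t x tT; have [Kx|/(I0 _ _ tT) ->] := pselect (K x).
  apply: HM; last by exists (t, x).
  by rewrite (le_lt_trans (ler_norm M))// ltrDl.
by rewrite normr0 addr_ge0.
Qed.

(** The measure is changed first, then the integrand: narrow continuity handles the fixed function
    [I (t, .)], and compactness of [K] makes [I (s, .)] uniformly close to it for [s] near [t]. *)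
Lemma continuous_on_Rintegral (T : R) (mut : R -> probability (borelRV R d) R)
    (I : R * E -> R) (K : set E) :
  narrowly_continuous T mut -> continuous I -> compact K ->
  (forall t x, t \in `[0, T] -> ~ K x -> I (t, x) = 0) ->
  continuous_on T (fun t => \int[mut t]_x I (t, x : E)).
Proof.
move=> nar cI cK I0 t tT.
have [M HM] := compact_param_bounded cI cK I0.
apply/cvgrPdist_le => e e0; have e2 : 0 < e / 2 by rewrite divr_gt0.
have e4 : 0 < e / 4 by rewrite divr_gt0.
have H1 := nar t tT (fun x => I (t, x)) (@continuous_fix_fst I t cI)
  (ex_intro _ M (fun x => HM t x tT)).
have H2 : \forall s \near within `[0, T] (nbhs t),
    K `<=` (fun x => `|I (t, x) - I (s, x)| <= e / 2).
  move/compact_near_coveringP : cK; apply => x Kx.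
  have /cvgrPdist_le/(_ _ e4) := cI (t, x).
  case=> -[/= A B] [At Bx] AB; exists (B, A) => /=.
    by split => //; exact: cvg_within.
  move=> [y s] [/= By As].
  have h1 : `|I (t, x) - I (t, y)| <= e / 4.
    by apply: (AB (t, y)); split => //=; exact: nbhs_singleton.
  have h2 : `|I (t, x) - I (s, y)| <= e / 4 by apply: (AB (s, y)).
  by move: h1 h2; rewrite !ler_norml => /andP[? ?] /andP[? ?]; apply/andP; split; lra.
near=> s.
have sT : s \in `[0, T] by near: s; exact: withinT.
rewrite -(subrKA (\int[mut s]_x I (t, x : E))) (le_trans (ler_normD _ _))//.
rewrite (splitr e) lerD//.
  by near: s; move/cvgrPdist_le : H1; apply.
apply: (@Rintegral_dist_le _ _ (mut s) (fun x => I (t, x)) (fun x => I (s, x)) M).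
- exact: continuous_fix_fst.
- exact: continuous_fix_fst.
- by move=> x; exact: HM.
- by move=> x; exact: HM.
- move=> x; have [Kx|nK] := pselect (K x).
    by move: x Kx; near: s.
  by rewrite !I0// subrr normr0 ltW.
Unshelve. all: by end_near. Qed.

End ParametricIntegral.

(** * Barriers and transport of the support *)

Section Barrier.
Context {R : realType} {d : nat}.
Local Notation E := 'rV[R]_d.
Variables (v : E -> E) (K sg lam : R) (p : R -> E).
Hypothesis v_smooth : forall i, smooth (fun x => v x 0 i).
Hypothesis vK : forall x y, `|dot (x - y) (v x - v y)| <= K * dot (x - y) (x - y).
Hypothesis p_curve : integral_curve v p.
Hypothesis sg_unit : sg = 1 \/ sg = - 1.
Hypothesis lam_gt0 : 0 < lam.

Let c (t : R) := lam * expR (- (2 * K * sg) * t).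
Let dist2 (z : R * E) := dot (z.2 - p z.1) (z.2 - p z.1).
Let q z := c z.1 * dist2 z.
(* With [sg = 1] (resp. [-1]) the weight [c] makes [q] nonincreasing (resp. nondecreasing) along the
   trajectories of [v]; [barrier_rate] is the derivative of [barrier] along them. *)
Definition barrier (z : R * E) : R := flat 0 (1 - q z).
Definition barrier_rate (z : R * E) : R :=
  flat 2 (1 - q z) * (2 * c z.1 *
    (K * sg * dist2 z - dot (z.2 - p z.1) (v z.2 - v (p z.1)))).

Let c_gt0 t : 0 < c t. Proof. by rewrite mulr_gt0 ?expR_gt0. Qed.

Let p_Ck k i : Ck k (fun t => p t 0 i).
Proof. exact: (integral_curve_Ck v_smooth p_curve). Qed.

Let c_Ck k : Ck k c.
Proof.
apply: CkM; first exact: Ck_cst.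
apply: (@Ck_comp1 _ _ _ expR (fun t => - (2 * K * sg) * t)); first exact: Ck_expR.
by apply: CkM; [exact: Ck_cst|exact: Ck_id].
Qed.

Let diff_Ck k i : Ck k (fun z : R * E => (z.2 - p z.1) 0 i).
Proof.
rewrite (_ : (fun _ => _) = fun z : R * E => z.2 0 i - p z.1 0 i); last first.
  by apply/funext => z; rewrite !mxE.
apply: CkB; first by apply: (@Ck_snd _ _ _ _ (fun x : E => x 0 i)); exact: Ck_coord.
exact: (@Ck_fst _ _ _ _ (fun t => p t 0 i)).
Qed.

Let dist2_Ck k : Ck k dist2.
Proof. by apply: Ck_sum => i; apply: CkM; exact: diff_Ck. Qed.

Let q_Ck k : Ck k (fun z => 1 - q z).
Proof.
apply: CkB; first exact: Ck_cst.
by apply: CkM; [exact: Ck_fst|exact: dist2_Ck].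
Qed.

Lemma barrier_Ck k : Ck k barrier.
Proof. by apply: (@Ck_comp1 _ _ _ (flat 0)); [exact: flat_smooth|exact: q_Ck]. Qed.

Lemma barrier_rate_Ck k : Ck k barrier_rate.
Proof.
apply: CkM; first by apply: (@Ck_comp1 _ _ _ (flat 2)); [exact: flat_smooth|exact: q_Ck].
apply: CkM.
  by apply: CkM; [exact: Ck_cst|exact: Ck_fst].
apply: CkB; first by apply: CkM; [exact: Ck_cst|exact: dist2_Ck].
apply: Ck_sum => i; apply: CkM; first exact: diff_Ck.
rewrite (_ : (fun _ => _) = fun z : R * E => v z.2 0 i - v (p z.1) 0 i); last first.
  by apply/funext => z; rewrite !mxE.
apply: CkB; first by apply: (@Ck_snd _ _ _ _ (fun x : E => v x 0 i)); exact: v_smooth.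
apply: (@Ck_fst _ _ _ _ (fun t => v (p t) 0 i)).
exact: (Ck_comp_row (v_smooth i k) (p_Ck k)).
Qed.

Lemma barrier_ge0 z : 0 <= barrier z. Proof. exact: flat_ge0. Qed.

(** The case [sg = 1] is the upper bound contained in [vK], the case [sg = - 1] the lower one. *)
Lemma barrier_rate_sg z : 0 <= sg * barrier_rate z.
Proof.
have := vK z.2 (p z.1); rewrite /barrier_rate -/(dist2 z); set D := dot _ (v _ - _).
rewrite ler_norml => /andP[? ?].
rewrite (_ : sg * _ = flat 2 (1 - q z) * (2 * c z.1) * (sg * (K * sg * dist2 z - D))); last by ring.
have c2 : 0 <= 2 * c z.1 by rewrite mulr_ge0// ltW.
apply: mulr_ge0; first by rewrite mulr_ge0 ?flat_ge0.
by case: sg_unit => ->; lra.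
Qed.

Lemma barrier_neq0 z : (barrier z != 0) = (q z < 1).
Proof.
rewrite /barrier; have [q1|q1] := ltP (q z) 1.
  by rewrite gt_eqF// flat_gt0// subr_gt0.
by rewrite flat_neg ?eqxx// subr_le0.
Qed.

Lemma barrier_rate_eq0 z : barrier z = 0 -> barrier_rate z = 0.
Proof.
move/eqP; apply: contraTeq => H; rewrite barrier_neq0 ltNge; apply: contra H => q1.
by rewrite /barrier_rate flat_neg ?mul0r// subr_le0.
Qed.

Lemma barrier_support (T : R) : exists2 B : set E, compact B &
  forall t x, t \in `[0, T] -> barrier (t, x) != 0 -> B x.
Proof.
pose m t := `|p t| + (c t)^-1.
have cm : continuous m.
  move=> t; have cp : p @ t --> p t by apply: continuous_row => i; exact: (p_Ck 0 i).
  apply: cvgD; first exact: (cvg_norm cp).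
  by apply: cvgV; [rewrite gt_eqF|exact: (c_Ck 0)].
have /compact_bounded[M [_ HM]] : compact (m @` `[0, T]%classic).
  by apply: continuous_compact; [exact: continuous_subspaceT|exact: segment_compact].
(* One unit puts the bound on [m] strictly above [M]; the other comes from [|y| <= y^2 + 1], which
   spares a square root. *)
pose rho := `|M| + 1 + 1.
exists [set x | `|x| <= rho].
  apply: bounded_closed_compact.
    exists rho; split; first exact: num_real.
    by move=> y rhoy x /= xr; rewrite (le_trans xr)// ltW.
  apply: (@closed_comp _ _ (fun x : E => `|x|) [set y | y <= rho]); last exact: closed_le.
  by move=> x _; exact: norm_continuous.
move=> t x tT; rewrite barrier_neq0 /q mulrC -ltr_pdivlMr// div1r => /= Hq.
have Hm : `|m t| <= `|M| + 1.
  apply: HM; last by exists t.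
  by rewrite (le_lt_trans (ler_norm M))// ltrDl.
apply: row_norm_le => [|i]; first by rewrite !addr_ge0.
have Hi : ((x - p t) 0 i) ^+ 2 <= dist2 (t, x).
  rewrite /dist2/= /dot (bigD1 i)//= -expr2 lerDl; apply: sumr_ge0 => j _.
  by rewrite -expr2 sqr_ge0.
have Hp := coord_le_norm (p t) i.
have H3 : `|x 0 i| <= `|p t 0 i| + `|(x - p t) 0 i|.
  by rewrite !mxE; apply: le_trans (ler_normD _ _); rewrite addrCA subrr addr0.
have H4 : `|(x - p t) 0 i| <= ((x - p t) 0 i) ^+ 2 + 1.
  rewrite -[_ ^+ 2]real_normK ?num_real//; set y := `|_|.
  have : 0 <= (y - 1) ^+ 2 by exact: sqr_ge0.
  have : 0 <= y := normr_ge0 _.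
  rewrite !expr2; nra.
move: Hm; rewrite /rho /m => /(le_trans (ler_norm _)); lra.
Qed.

Let dist2_dt (t : R) (x : E) : is_derive t (1 : R) (fun s => dist2 (s, x))
  (- (2 * dot (x - p t) (v (p t)))).
Proof.
have D i : is_derive t (1 : R) (fun s => (x - p s) 0 i) (- v (p t) 0 i).
  rewrite (_ : (fun s => _) = (fun s => x 0 i - p s 0 i)).
    have := is_deriveB_fun (is_derive_cst (x 0 i) t 1) (p_curve t i).
    by rewrite sub0r.
  by apply/funext => s; rewrite !mxE.
have := is_derive_sum_fun (fun i => is_deriveM_fun (D i) (D i)).
rewrite /dist2 /dot mulr_sumr -sumrN => H; apply: is_derive_eq H _.
by apply: eq_bigr => i _; ring.
Qed.

Let dist2_dx (t : R) (x : E) j : is_derive x (delta_mx 0 j : E) (fun y => dist2 (t, y))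
  (2 * (x - p t) 0 j).
Proof.
have D i : is_derive x (delta_mx 0 j : E) (fun y : E => (y - p t) 0 i) ((i == j)%:R).
  rewrite (_ : (fun y => _) = (fun y : E => y 0 i - p t 0 i)); last first.
    by apply/funext => s; rewrite !mxE.
  have D0 : is_derive x (delta_mx 0 j : E) (fun y : E => y 0 i) ((i == j)%:R).
    apply: DeriveDef; first exact: diff_derivable (differentiable_coord _ _ _).
    by rewrite derive_coord mxE eqxx/=.
  have := is_deriveB_fun D0 (is_derive_cst (p t 0 i) x (delta_mx 0 j)).
  by rewrite subr0.
have := is_derive_sum_fun (fun i => is_deriveM_fun (D i) (D i)).
rewrite /dist2 /dot => H; apply: is_derive_eq H _.
rewrite (bigD1 j)//= eqxx big1 ?addr0 => [|i /negbTE ->].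
  by rewrite !mulr1 mulr2n mulrDl !mul1r.
by rewrite !mulr0 addr0.
Qed.

Let flat_dV (V : normedModType R) (z u : V) (f : V -> R) (a : R) : is_derive z u f a ->
  is_derive z u (fun y => flat 0 (1 - f y)) (- (flat 2 (1 - f z) * a)).
Proof.
move=> df; have := is_deriveB_fun (is_derive_cst (1 : R) z u) df; rewrite sub0r => df1.
have := is_derive_comp1 (flat_is_derive 0 _) df1.
by rewrite oppr0 mul0r add0r mulrN.
Qed.

(** As [flat 0] has derivative [flat 2], what matters is the derivative of [q] along [v]: the weight
    gives [- 2 K sg c |x - p|^2], the moving centre [- 2 c (x - p) . v p], and the gradient
    [2 c (x - p) . v x]. *)
Lemma barrier_transport (chi dchi : R -> R) (t : R) (x : E) :
  (forall t : R, is_derive t (1 : R) chi (dchi t)) ->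
  derive1 (fun s => chi s * barrier (s, x)) t +
    dot (grad (fun y => chi t * barrier (t, y)) x) (v x) =
  dchi t * barrier (t, x) + chi t * barrier_rate (t, x).
Proof.
move=> Dchi.
have Dc : is_derive t (1 : R) c (- (2 * K * sg) * c t).
  have := is_deriveM_fun (is_derive_cst lam t 1) (is_derive_expR_lin (- (2 * K * sg)) t).
  rewrite mulr0 addr0 => H; apply: is_derive_eq H _; rewrite /c /=; ring.
have Dt := is_deriveM_fun (Dchi t) (flat_dV (is_deriveM_fun Dc (dist2_dt t x))).
rewrite derive1E (derive_val (is_derive := Dt)).
have Dx j : 'D_(delta_mx 0 j) (fun y => chi t * barrier (t, y)) x =
    chi t * (- (flat 2 (1 - q (t, x)) * (c t * (2 * (x - p t) 0 j)))).
  have := is_deriveM_fun (is_derive_cst (c t) x _) (dist2_dx t x j); rewrite mulr0 addr0 => H.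
  have := is_deriveM_fun (is_derive_cst (chi t) x _) (flat_dV H); rewrite mulr0 addr0 => -[_ <-].
  by [].
have -> : dot (grad (fun y => chi t * barrier (t, y)) x) (v x) =
    chi t * - (flat 2 (1 - q (t, x)) * (c t * 2)) * dot (x - p t) (v x).
  rewrite /dot mulr_sumr; apply: eq_bigr => i _; rewrite [grad _ _ _ _]mxE.
  rewrite (Dx i); ring.
rewrite /barrier_rate /=.
have -> : dot (x - p t) (v x - v (p t)) = dot (x - p t) (v x) - dot (x - p t) (v (p t)).
  by rewrite /dot -sumrB; apply: eq_bigr => i _; rewrite !mxE; ring.
rewrite -/(barrier (t, x)) /q/=; ring.
Qed.

End Barrier.

Section Transport.
Context {R : realType} {d : nat}.
Local Notation E := 'rV[R]_d.
Variables (v : E -> E) (K T : R) (mut : R -> probability (borelRV R d) R).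
Hypothesis v_smooth : forall i, smooth (fun x => v x 0 i).
Hypothesis vK : forall x y, `|dot (x - y) (v x - v y)| <= K * dot (x - y) (x - y).
Hypothesis T_gt0 : 0 < T.
Hypothesis mut_narrow : narrowly_continuous T mut.
Hypothesis mut_CE : continuity_equation T mut (fun _ => v).

Section OneBarrier.
Variables (sg lam : R) (p : R -> E).
Hypothesis p_curve : integral_curve v p.
Hypothesis sg_unit : sg = 1 \/ sg = - 1.
Hypothesis lam_gt0 : 0 < lam.

Let B := barrier K sg lam p.
Let D := barrier_rate v K sg lam p.
Let G t := \int[mut t]_x B (t, x : E).

Let B_Ck k : Ck k B. Proof. exact: (barrier_Ck K sg lam v_smooth p_curve). Qed.

Let G_cont : continuous_on T G.
Proof.
have [A cA HA] := barrier_support K sg v_smooth p_curve lam_gt0 T.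
apply: (continuous_on_Rintegral mut_narrow (Ck_continuous (B_Ck 0)) cA) => t x tT nA.
by apply: contrapT => /eqP /(HA t x tT).
Qed.

Lemma barrier_Rintegral_monotone (u : R) : 0 < u < T -> sg * G 0 <= sg * G u.
Proof.
have [A cA HA] := barrier_support K sg v_smooth p_curve lam_gt0 T.
have B0 t x : t \in `[0, T] -> ~ A x -> B (t, x) = 0.
  by move=> tT nA; apply: contrapT => /eqP /(HA t x tT).
have D0 t x : t \in `[0, T] -> ~ A x -> D (t, x) = 0.
  by move=> tT nA; apply: barrier_rate_eq0; exact: B0.
have sG_cont : continuous_on T (fun t => sg * G t).
  by move=> t tT; apply: cvgM; [exact: cvg_cst|exact: G_cont].
have mono := weak_nondecreasing sG_cont.
have {}mono (a b : R) : 0 < a -> a < b -> b < T -> sg * G a <= sg * G b.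
  apply: mono => chi dchi {}a {}b a0 bT chi_smooth Dchi dchi_cont chi0 chi_supp.
  have schi_D (t : R) : is_derive t (1 : R) (fun t => sg * chi t) (sg * dchi t).
    have := is_deriveM_fun (is_derive_cst sg t 1) (Dchi t).
    by rewrite mulr0 addr0.
  (* The integrand [I] of the equation tested with [psi] exceeds [sg * dchi * B] by
     [sg * chi * D >= 0]; this is the inequality that [weak_nondecreasing] asks of [sg * G]. *)
  pose psi (z : R * E) := sg * chi z.1 * B z.
  pose I (z : R * E) := sg * dchi z.1 * B z + sg * chi z.1 * D z.
  have psi_test : test_function (`]0, T[%classic `*` [set: E]) psi.
    have S_sub : [set z | psi z != 0] `<=` `[a, b]%classic `*` A.
      move=> [t x] /=; rewrite /psi /= !mulf_eq0 !negb_or => /andP[/andP[_ ct] Bt].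
      have tab := chi_supp t ct; split => /=; first by rewrite in_itv.
      apply: HA Bt; rewrite in_itv/=; lra.
    have cS : compact (`[a, b]%classic `*` A) by apply: compact_setX => //; exact: segment_compact.
    have clS := compact_closed (@norm_hausdorff _ _) cS.
    have F_sub : fsupp psi `<=` `[a, b]%classic `*` A.
      by rewrite [X in _ `<=` X]((closure_id _).1 clS); exact: closureS.
    split.
    - move=> k; apply: CkM; last exact: B_Ck.
      apply: CkM; first exact: Ck_cst.
      exact: Ck_fst.
    - by apply: subclosed_compact cS _ => //; exact: closed_closure.
    - apply: subset_trans F_sub _ => -[t x] [/= + _]; rewrite !in_itv/= => tab.
      by split => //=; lra.
  have cI : continuous I.
    apply: (@Ck_continuous _ _ 0); apply: CkD; apply: CkM.
    - by apply: CkM; [exact: Ck_cst|exact: (@Ck_fst _ _ _ 0)].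
    - exact: B_Ck.
    - by apply: CkM; [exact: Ck_cst|exact: (@Ck_fst _ _ _ 0)].
    - exact: (barrier_rate_Ck K sg lam v_smooth p_curve 0).
  have I0 t x : t \in `[0, T] -> ~ A x -> I (t, x) = 0.
    by move=> tT nA; rewrite /I B0// D0// !mulr0 addr0.
  have [M HM] := compact_param_bounded cI cA I0.
  have [MB HMB] := compact_param_bounded (Ck_continuous (B_Ck 0)) cA B0.
  exists (fun t => \int[mut t]_x I (t, x : E)).
    split; first exact: (continuous_on_Rintegral mut_narrow cI cA I0).
    rewrite -[RHS](mut_CE.2 psi psi_test); apply: eq_integral => t.
    rewrite inE /= in_itv/= => /andP[t0 tT].
    have tT' : t \in `[0, T] by rewrite in_itv/= !ltW.
    rewrite /Rintegral fineK; last first.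
      apply: integrable_fin_num => //.
      exact: (bounded_continuous_integrable _ (@continuous_fix_fst _ _ I t cI)
        (fun x => HM t x tT')).
    apply: eq_integral => x _; congr (_%:E).
    exact: esym (barrier_transport K sg lam p_curve t x schi_D).
  move=> t tT; have tT' : t \in `[0, T] by rewrite in_itv.
  have cB : continuous (fun x => B (t, x)) by apply: (continuous_fix_fst (Ck_continuous (B_Ck 0))).
  have IB := bounded_continuous_integrable (mut t) cB (fun x => HMB t x tT').
  have II := bounded_continuous_integrable _ (@continuous_fix_fst _ _ I t cI) (fun x => HM t x tT').
  rewrite mulrCA mulrA -RintegralZl//.
  apply: le_Rintegral => //.
    exact: (integrableZl measurableT (sg * dchi t) IB).
    exact: II.
  move=> x _; rewrite /I/= lerDl mulrAC mulr_ge0//.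
  exact: barrier_rate_sg.
(* So far both times lie in the open interval. If the claim failed, continuity of [G] at 0 would
   supply a time [a] in []0, u[] contradicting [mono]. *)
move=> /andP[u0 uT]; rewrite leNgt; apply/negP => Gu.
have e0 : 0 < sg * G 0 - sg * G u by rewrite subr_gt0.
have zT : (0 : R) \in `[0, T] by rewrite in_itv/= lexx ltW.
have [r r0 Hr] := continuous_on_ball sG_cont zT e0.
pose a := Num.min r u / 2.
have a0 : 0 < a by rewrite divr_gt0// lt_min r0.
have ar : a < r by rewrite /a; have : Num.min r u <= r by [rewrite ge_min lexx]; lra.
have a_u : a < u by rewrite /a; have : Num.min r u <= u by [rewrite ge_min lexx orbT]; lra.
have := mono a u a0 a_u uT.
have : `|sg * G 0 - sg * G a| < sg * G 0 - sg * G u.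
  by apply: Hr; [lra|rewrite sub0r normrN gtr0_norm].
rewrite ltr_norml => /andP[]; lra.
Qed.

End OneBarrier.
End Transport.

Section SupportTransport.
Context {R : realType} {d : nat}.
Local Notation E := 'rV[R]_d.

Lemma open_barrier_neq0 (v : E -> E) (K sg lam : R) (p : R -> E) (t : R) :
  (forall i, smooth (fun x => v x 0 i)) -> integral_curve v p ->
  open [set x | barrier K sg lam p (t, x) != 0].
Proof.
move=> vs cp; apply: (@open_comp _ _ (fun x => barrier K sg lam p (t, x)) [set y | y != 0]).
  move=> x _; apply: (continuous_fix_fst (I := barrier K sg lam p)).
  exact: (Ck_continuous (barrier_Ck K sg lam vs cp 0)).
exact: open_neq.
Qed.

(** At a fixed time, and for any [sg], the sets where the barriers do not vanish are the open
    Euclidean balls around [p t], of every positive radius as [lam] varies. *)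
Lemma msupp_barrierP (nu : probability (borelRV R d) R) (v : E -> E) (K sg : R)
    (p : R -> E) (t : R) :
  (forall i, smooth (fun x => v x 0 i)) -> integral_curve v p ->
  msupp nu (p t) <->
  (forall lam : R, (0 < lam)%R -> 0 < nu [set x | (barrier K sg lam p (t, x) != 0)%R])%E.
Proof.
move=> vs cp; split=> [Sp lam lam0|H U oU Up].
  apply: Sp; first exact: open_barrier_neq0 vs cp.
  by rewrite /= barrier_neq0/= subrr /dot big1 ?mulr0// => i _; rewrite mxE mul0r.
have : nbhs (p t) U by apply: open_nbhs_nbhs.
move=> /nbhs_ballP[r /= r0 rU].
pose e := expR (- (2 * K * sg) * t).
have e0 : 0 < e by exact: expR_gt0.
(* For this [lam] the condition [q < 1] says that the Euclidean distance to [p t] is less than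
   [r]. *)
have lam0 : 0 < (e * r ^+ 2)^-1 by rewrite invr_gt0 mulr_gt0// exprn_gt0.
apply: lt_le_trans (H _ lam0) _; apply: le_measure; rewrite ?inE.
- by apply: open_measurable_borelRV; exact: open_barrier_neq0 vs cp.
- exact: open_measurable_borelRV.
move=> x /=; rewrite barrier_neq0/= -/e => Hx; apply: rU.
rewrite -ball_normE/= distrC; apply: le_lt_trans (norm_le_enorm _) _.
rewrite -(ltr_pXn2r (n := 2))// ?nnegrE ?enorm_ge0 ?(ltW r0)// enorm_sqr.
move: Hx; set D := dot _ _; rewrite (_ : _ * e * D = D / r ^+ 2); last first.
  by field; rewrite !gt_eqF.
by rewrite ltr_pdivrMr ?exprn_gt0// mul1r.
Qed.

(** The sign 1 carries positive mass forward from 0 to [t], the sign -1 carries it backward. For one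
    [lam] the balls at the two times have different radii, but every [lam] is considered. *)
Lemma msupp_transport (v : E -> E) (K T : R) (mut : R -> probability (borelRV R d) R)
    (p : R -> E) (t : R) :
  (forall i, smooth (fun x => v x 0 i)) ->
  (forall x y, `|dot (x - y) (v x - v y)| <= K * dot (x - y) (x - y)) ->
  narrowly_continuous T mut -> continuity_equation T mut (fun=> v) ->
  integral_curve v p -> 0 < t < T ->
  msupp (mut t) (p t) <-> msupp (mut 0) (p 0).
Proof.
move=> vs vK nar CE cp tT; have T0 : 0 < T by lra.
have G_gt0 sg lam s : 0 < lam -> 0 <= s <= T ->
    (0 < \int[mut s]_x barrier K sg lam p (s, x : E)) =
    (0 < mut s [set x | (barrier K sg lam p (s, x) != 0)%R])%E.
  move=> lam0 sT; have [A cA HA] := barrier_support K sg vs cp lam0 T.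
  have Bc := Ck_continuous (barrier_Ck K sg lam vs cp 0).
  have B0 r x : r \in `[0, T] -> ~ A x -> barrier K sg lam p (r, x) = 0.
    by move=> rT nA; apply: contrapT => /eqP /(HA r x rT).
  have [M HM] := compact_param_bounded Bc cA B0.
  apply: (@Rintegral_gt0 _ _ _ (fun x => barrier K sg lam p (s, x)) M).
  - exact: continuous_fix_fst.
  - by move=> x; apply: HM; rewrite in_itv.
  - by move=> x; exact: barrier_ge0.
have mono := barrier_Rintegral_monotone vs vK T0 nar CE cp.
split=> [/(msupp_barrierP _ K (-1) _ vs cp)|/(msupp_barrierP _ K 1 _ vs cp)] H.
  apply/(msupp_barrierP _ K (-1) _ vs cp) => lam lam0; rewrite -G_gt0//; last by lra.
  have := H lam lam0; rewrite -G_gt0//; last by lra.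
  by have := mono (-1) lam (or_intror erefl) lam0 t tT; rewrite !mulN1r lerN2; lra.
apply/(msupp_barrierP _ K 1 _ vs cp) => lam lam0; rewrite -G_gt0//; last by lra.
have := H lam lam0; rewrite -G_gt0//; last by lra.
by have := mono 1 lam (or_introl erefl) lam0 t tT; rewrite !mul1r; lra.
Qed.

Lemma interior_image_homeo (f g : E -> E) (S : set E) : continuous f -> continuous g ->
  cancel f g -> cancel g f -> interior (f @` S) = f @` interior S.
Proof.
move=> cf cg fK gK; apply/seteqP; split=> [y Sy|_ [x Sx <-]].
  exists (g y) => //.
  have := cf (g y) (f @` S); rewrite gK => /(_ Sy); rewrite /= nbhs_simpl /=.
  by apply: filterS => z [x Sx /(can_inj fK) <-].
have := cg (f x) S; rewrite fK => /(_ Sx); rewrite /= nbhs_simpl /=.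
by apply: filterS => z Sz; exists (g z).
Qed.

End SupportTransport.

(** * Expansion of the flow and shape derivative *)

Section TestFields.
Context {R : realType} {d : nat}.
Local Notation E := 'rV[R]_d.

Lemma smooth_derive {V : normedModType R} (f : V -> R) v : smooth f -> smooth ('D_v f).
Proof. by move=> sf k; exact: (sf k.+1).2. Qed.

Lemma test_family_bounds (F : 'I_d -> E -> R) :
  (forall i, smooth (F i)) -> (forall i, compact (fsupp (F i))) ->
  exists2 C : R, 0 <= C & forall i,
    (forall x, `|F i x| <= C) /\ (forall x y, `|F i x - F i y| <= C * `|x - y|).
Proof.
move=> sF cF.
have /choice[C HC] i : exists C : R, [/\ 0 <= C, forall x, `|F i x| <= C &
    forall x y, `|F i x - F i y| <= C * `|x - y|].
  have [A A0 HA] := compact_supp_bounded (sF i 0) (cF i).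
  have [B B0 HB] := compact_supp_Lipschitz (sF i 1) (cF i).
  exists (A + B); split=> [|x|x y]; first exact: addr_ge0.
    by apply: le_trans (HA x) _; rewrite lerDl.
  by apply: le_trans (HB x y) _; rewrite ler_wpM2r// lerDr.
exists (\sum_i C i); first by apply: sumr_ge0 => i _; have [] := HC i.
move=> i; have [C0 H1 H2] := HC i.
have le_C : C i <= \sum_i C i.
  by rewrite (bigD1 i)//= lerDl; apply: sumr_ge0 => j _; have [] := HC j.
split=> [x|x y]; first exact: le_trans (H1 x) le_C.
by apply: le_trans (H2 x y) _; rewrite ler_wpM2r.
Qed.

Lemma W1inf_norm_ge0 (theta : E -> E) : 0 <= W1inf_norm theta.
Proof.
(* The [sup] of a set that is empty or unbounded above is 0 by convention, which covers fields
   outside [W1inf]. *)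
have sup_ge0 (S : set R) : (forall r, S r -> 0 <= r) -> 0 <= sup S.
  move=> S0; have [[[r Sr] ubS]|/sup_out ->//] := pselect (has_sup S).
  by apply: le_trans (S0 r Sr) _; exact: ub_le_sup.
apply: addr_ge0; apply: sup_ge0 => _ [x _ <-]; first exact: enorm_ge0.
by rewrite divr_ge0 ?enorm_ge0.
Qed.

End TestFields.

Section FlowDeformation.
Context {R : realType} {d : nat}.
Local Notation E := 'rV[R]_d.
Variable phi : E -> R.
Hypothesis phi_test : test_function setT phi.

Let v := grad phi.

Let vE i : (fun x => v x 0 i) = 'D_(delta_mx 0 i) phi.
Proof. by apply/funext => x; rewrite /v /grad mxE. Qed.

Lemma grad_smooth i : smooth (fun x => v x 0 i).
Proof. by rewrite vE; apply: smooth_derive; case: phi_test. Qed.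

Let v_supp i : compact (fsupp (fun x => v x 0 i)).
Proof.
have [_ cphi _] := phi_test; rewrite vE.
by apply: compact_fsupp_sub cphi _ => x; exact: derive_notin_fsupp.
Qed.

(** The acceleration field: the second time derivative of coordinate [i] of a trajectory is [w i] at
    its current position. *)
Let w (i : 'I_d) (x : E) := \sum_j v x 0 j * 'D_(delta_mx 0 j) (fun x => v x 0 i) x.

Let w_smooth i : smooth (w i).
Proof.
move=> k; apply: Ck_sum => j; apply: CkM; first exact: grad_smooth.
exact: (smooth_derive (delta_mx 0 j) (grad_smooth i)).
Qed.

Let w_supp i : compact (fsupp (w i)).
Proof.
apply: (@compact_fsupp_sub _ _ (fun x => v x 0 i) (w i) (@v_supp i)) => x nx.
rewrite /w big1// => j _.
by rewrite (derive_notin_fsupp _ nx) mulr0.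
Qed.

Lemma grad_flow_ex : exists (X : E -> R -> E) (K C : R),
  [/\ 0 <= C,
      forall x y, `|dot (x - y) (v x - v y)| <= K * dot (x - y) (x - y),
      forall x, X x 0 = x,
      forall x, integral_curve v (X x) &
      [/\ W1inf v,
      forall h : R, 0 < h -> h <= 1 ->
        W1inf (fun x => X x h - x) /\ W1inf_norm (fun x => X x h - x) <= C * h &
      forall h : R, 0 < h -> h <= 1 ->
        W1inf (fun x => X x h - x - h *: v x) /\
        W1inf_norm (fun x => X x h - x - h *: v x) <= C * h ^+ 2]].
Proof.
have [A A0 HA] := test_family_bounds grad_smooth v_supp.
have [B B0 HB] := test_family_bounds w_smooth w_supp.
pose L := A + 1.
have L1 : 1 <= L by rewrite /L; lra.
have vL x y i : `|v x 0 i - v y 0 i| <= L * `|x - y|.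
  by apply: le_trans ((HA i).2 x y) _; rewrite ler_wpM2r// /L; lra.
have [X [X0 cX]] : exists X : E -> R -> E,
    (forall x, X x 0 = x) /\ (forall x, integral_curve v (X x)).
  pose ex x := flow_curve_ex L1 vL (fun x i => (HA i).1 x) x.
  by exists (fun x => s2val (ex x)); split=> x; case: (ex x).
pose K := d%:R * L.
have K0 : 0 <= K by rewrite mulr_ge0//; lra.
have vK : forall x y, `|dot (x - y) (v x - v y)| <= K * dot (x - y) (x - y).
  exact: dot_le_Lipschitz.
have Dv x i (t : R) : is_derive t (1 : R) (fun s => v (X x s) 0 i) (w i (X x t)).
  have vd : forall y, differentiable (fun x => v x 0 i) y by case: (grad_smooth i 1).
  exact: (is_derive_along t vd (cX x)).
have T1 x i (h : R) : 0 < h -> `|X x h 0 i - x 0 i - h * v x 0 i| <= B * h ^+ 2.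
  move=> h0; have := taylor2_le (ltW h0) (fun s => cX x s i) (Dv x i) (fun s _ => (HB i).1 (X x s)).
  by rewrite X0.
(* For [s <= 1] the accelerations of two trajectories differ by at most
   [B |X x s - X y s| <= B e^K |x - y|]; this controls the Lipschitz constant of the Taylor
   remainder. *)
pose Q := B * expR K.
have Q0 : 0 <= Q by rewrite mulr_ge0 ?expR_ge0.
have T2 x y i (h : R) : 0 < h -> h <= 1 ->
    `|(X x h 0 i - x 0 i - h * v x 0 i) - (X y h 0 i - y 0 i - h * v y 0 i)|
    <= Q * enorm (x - y) * h ^+ 2.
  move=> h0 h1.
  have D1 (t : R) := is_deriveB_fun (cX x t i) (cX y t i).
  have D2 (t : R) := is_deriveB_fun (Dv x i t) (Dv y i t).
  have := taylor2_le (ltW h0) D1 D2 (Q := Q * enorm (x - y)).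
  rewrite !X0 => H; rewrite [X in `|X|](_ : _ = X x h 0 i - X y h 0 i - (x 0 i - y 0 i) -
    h * (v x 0 i - v y 0 i)); last by ring.
  apply: H => s /andP[s0 sh]; apply: le_trans ((HB i).2 _ _) _.
  rewrite -mulrA ler_wpM2l//; apply: le_trans (norm_le_enorm _) _.
  apply: le_trans (flow_enorm_le vK X0 cX _ _ _) _; rewrite ler_wpM2r ?enorm_ge0//.
  by rewrite ler_expR ger0_norm// ler_piMr//; lra.
have vW x y i : `|v x 0 i - v y 0 i| <= L * enorm (x - y).
  by apply: le_trans (vL x y i) _; rewrite ler_wpM2l ?norm_le_enorm//; lra.
exists X, K, (d%:R * (A + L + B + Q)); split => //.
  by rewrite mulr_ge0// !addr_ge0//; lra.
split.
- by apply: (proj1 (W1inf_le A0 _ _ vW)); [lra|move=> x i; exact: (HA i).1].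
(* As [h <= 1], the quadratic remainders are absorbed into linear bounds, and one constant serves
   both estimates. *)
- move=> h h0 h1; have h2 : h ^+ 2 <= h by rewrite expr2 ler_piMr// ltW.
  have C1 : 0 <= (A + B) * h by rewrite mulr_ge0 ?addr_ge0// ltW.
  have C2 : 0 <= (L + Q) * h by rewrite mulr_ge0 ?addr_ge0//; lra.
  have [||W Wle] := @W1inf_le _ _ (fun x => X x h - x) _ _ C1 C2.
  + move=> x i; rewrite !mxE -[X in `|X|](subrK (h * v x 0 i)).
    apply: le_trans (ler_normD _ _) _.
    rewrite (_ : (A + B) * h = B * h + h * A); last by ring.
    apply: lerD; first by apply: le_trans (T1 x i h h0) _; rewrite ler_wpM2l.
    by rewrite normrM (gtr0_norm h0) ler_wpM2l ?(ltW h0)//; exact: (HA i).1.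
  + move=> x y i; rewrite !mxE.
    rewrite [X in `|X|](_ : _ = (X x h 0 i - x 0 i - h * v x 0 i) -
      (X y h 0 i - y 0 i - h * v y 0 i) + h * (v x 0 i - v y 0 i)); last by ring.
    apply: le_trans (ler_normD _ _) _.
    rewrite (_ : (L + Q) * h * _ = Q * h * enorm (x - y) + L * h * enorm (x - y)); last by ring.
    apply: lerD.
      apply: le_trans (T2 x y i h h0 h1) _; rewrite mulrAC ler_wpM2r ?enorm_ge0//.
      by rewrite ler_wpM2l.
    by rewrite normrM (gtr0_norm h0) mulrAC mulrC ler_wpM2r ?(ltW h0).
  split=> //; apply: le_trans Wle _; rewrite -mulrA ler_wpM2l// -mulrDl.
  by rewrite ler_wpM2r ?(ltW h0)//; lra.
- move=> h h0 h1.
  have h20 : 0 <= h ^+ 2 by rewrite sqr_ge0.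
  have C1 : 0 <= B * h ^+ 2 by rewrite mulr_ge0.
  have C2 : 0 <= Q * h ^+ 2 by rewrite mulr_ge0.
  have [||W Wle] := @W1inf_le _ _ (fun x => X x h - x - h *: v x) _ _ C1 C2.
  + by move=> x i; rewrite !mxE; have := T1 x i h h0; rewrite /v mxE.
  + by move=> x y i; rewrite mulrAC !mxE; have := T2 x y i h h0 h1; rewrite /v !mxE.
  split=> //; apply: le_trans Wle _; rewrite -mulrA ler_wpM2l// -mulrDl.
  by rewrite ler_wpM2r//; lra.
Qed.

End FlowDeformation.

Unset Implicit Arguments.
Set Strict Implicit.
Set Printing Implicit Defensive.

Theorem proposition2 (R : realType) (d : nat)
    (Oad : set (set 'rV[R]_d)) (J : set 'rV[R]_d -> R)
    (mu : probability (borelRV R d) R)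
    (dSJ : ('rV[R]_d -> 'rV[R]_d) -> R)
    (phi : 'rV[R]_d -> R) (T : R)
    (mut : R -> probability (borelRV R d) R)
    (Oad_admissible : admissible Oad)
    (mu_Pad : Pad Oad mu)
    (J_diff : is_shape_derivative Oad J (Omega mu) dSJ)
    (phi_test : test_function setT phi)
    (T_gt0 : 0 < T)
    (mut_P2 : forall t : R, t \in `[0, T] -> P2 (mut t))
    (mut_narrow : narrowly_continuous T mut)
    (mut0 : forall A : set (borelRV R d), measurable A -> mut 0 A = mu A)
    (mut_CE : continuity_equation T mut (fun _ => grad phi)) :
  (\forall t \near 0^'+, Pad Oad (mut t)) /\
  (h^-1 * (Jtilde J (mut h) - Jtilde J (mut 0)) @[h --> 0^'+] --> dSJ (grad phi)).
Proof.
have [X [K [C [C0 vK X0 cX [Wv Wt Wr]]]]] := grad_flow_ex phi_test.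
(* [mut 0] and [mu] agree on measurable sets, hence on the open sets that determine the support. *)
have Om0 : Omega (mut 0) = Omega mu.
  congr interior; apply/seteqP; split=> x Sx U oU Ux; have := Sx U oU Ux;
    by rewrite mut0//; exact: open_measurable_borelRV.
pose th h x := X x h - x.
have OmE h : 0 < h < T -> Omega (mut h) = deform (th h) (Omega mu).
  move=> hT; rewrite -Om0 /Omega.
  have -> : msupp (mut h) = (fun x => X x h) @` msupp (mut 0).
    have P x := msupp_transport (grad_smooth phi_test) vK mut_narrow mut_CE (cX x) hT.
    apply/seteqP; split=> [y Sy|_ [x Sx <-]]; last by apply/(P x); rewrite X0.
    exists (X y (- h)); last exact: flow_inv vK X0 cX _ _.
    have := (P (X y (- h))).1; rewrite X0 (flow_inv vK X0 cX); exact.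
  rewrite (@interior_image_homeo _ _ (fun x => X x h) (fun x => X x (- h))).
  - apply/seteqP; split=> _ [x Sx <-]; exists x => //; rewrite /th.
      by rewrite addrC subrK.
    by rewrite addrC subrK.
  - exact: flow_continuous vK X0 cX h.
  - exact: flow_continuous vK X0 cX (- h).
  - by move=> x; have := flow_inv vK X0 cX (- h) x; rewrite opprK.
  - by move=> x; exact: flow_inv vK X0 cX h x.
have [Oad_mu [J_lin [CL HCL]] Jo] := J_diff.
have [r r0 Hr] := Oad_admissible.2 _ Oad_mu.
have C1 : 0 < C + 1 by rewrite ltr_wpDl.
have small (s : R) : 0 < s -> \forall h \near 0^'+,
    [/\ 0 < h, h <= 1, h < T & W1inf_norm (th h) < s].
  move=> s0; near=> h.
  have h0 : 0 < h by near: h; exact: nbhs_right_gt.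
  have h1 : h <= 1 by near: h; exact: nbhs_right_le.
  have hT : h < T by near: h; exact: nbhs_right_lt.
  split=> //.
  apply: le_lt_trans (Wt h h0 h1).2 _.
  apply: le_lt_trans (_ : (C + 1) * h < _); first by rewrite ler_wpM2r ?(ltW h0)// lerDl.
  rewrite mulrC -ltr_pdivlMr//; near: h; apply: nbhs_right_lt; exact: divr_gt0.
split.
  near=> h; have [h0 h1 hT hr] : [/\ 0 < h, h <= 1, h < T & W1inf_norm (th h) < r].
    by near: h; exact: small.
  split; first by apply: mut_P2; rewrite in_itv/= !ltW.
  by rewrite OmE ?h0//; apply: Hr => //; exact: (Wt h h0 h1).1.
apply/cvgrPdist_le => e e0.
(* The remainder in the shape derivative is then at most [e1 * (C * h) <= e / 2 * h]; dividing by
   [C + 1] allows for [C = 0]. *)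
pose e1 := e / 2 / (C + 1).
have e10 : 0 < e1 by rewrite !divr_gt0.
have [r' r'0 Hr'] := Jo e1 e10.
near=> h.
have [h0 h1 hT hr] : [/\ 0 < h, h <= 1, h < T & W1inf_norm (th h) < Num.min r r'].
  by near: h; apply: small; rewrite lt_min r0.
move: hr; rewrite lt_min => /andP[hr hr'].
have [Wth Nth] := Wt h h0 h1; have [Wrh Nrh] := Wr h h0 h1.
rewrite /Jtilde Om0 OmE ?h0//.
have H1 := Hr' _ Wth hr' (Hr _ Wth hr).
(* Linearity of [dSJ] isolates [h * dSJ (grad phi)]. The remaining field has norm [O(h^2)], so by
   boundedness of [dSJ] it contributes at most [e / 2 * h] for small [h]. *)
have thE : th h = fun x => h *: grad phi x + (X x h - x - h *: grad phi x).
  by apply/funext => x; rewrite addrC subrK.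
have H2 : dSJ (th h) = h * dSJ (grad phi) + dSJ (fun x => X x h - x - h *: grad phi x).
  by rewrite {1}thE; exact: J_lin.
(* The sign of [CL] is unknown, hence its absolute value. *)
have H3 : `|dSJ (fun x => X x h - x - h *: grad phi x)| <= `|CL| * (C * h ^+ 2).
  apply: le_trans (HCL _ Wrh) _; apply: le_trans (_ : `|CL| * _ <= _); last exact: ler_wpM2l Nrh.
  by rewrite ler_wpM2r ?W1inf_norm_ge0// ler_norm.
have Ch : `|CL| * C * h <= e / 2.
  apply: le_trans (_ : (`|CL| * C + 1) * h <= _); first by rewrite ler_wpM2r ?(ltW h0)// lerDl.
  rewrite mulrC -ler_pdivlMr ?ltr_wpDl ?mulr_ge0//; near: h; apply: nbhs_right_le.
  by rewrite divr_gt0 ?divr_gt0 ?ltr_wpDl ?mulr_ge0.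
rewrite distrC (_ : h^-1 * _ - _ = h^-1 *
    ((J (deform (th h) (Omega mu)) - J (Omega mu) - dSJ (th h)) +
     dSJ (fun x => X x h - x - h *: grad phi x))); last first.
  by rewrite H2; field; rewrite gt_eqF.
rewrite normrM (gtr0_norm (_ : 0 < h^-1)) ?invr_gt0// mulrC ler_pdivrMr//.
apply: le_trans (ler_normD _ _) _.
apply: le_trans (lerD H1 H3) _.
have H4 : e1 * W1inf_norm (th h) <= e / 2 * h.
  apply: le_trans (_ : e1 * (C * h) <= _); first by rewrite ler_wpM2l// ltW.
  rewrite mulrA ler_wpM2r ?(ltW h0)// /e1 mulrAC ler_pdivrMr//.
  by rewrite ler_wpM2l ?lerDl// divr_ge0// ltW.
have H5 : `|CL| * (C * h ^+ 2) <= e / 2 * h.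
  by rewrite expr2 !mulrA ler_wpM2r// ltW.
by lra.
Unshelve. all: by end_near. Qed.
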